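(* Let $F_2$ be the free group of rank $2$, let $\eta_{F_2}:F_2\to \mathsf{Bau}(F_2)$ be its Baumslag rationalization, and let $\mathsf{CBau}(F_2)$ be the cokernel of $\eta_{F_2}$, i.e. the quotient of $\mathsf{Bau}(F_2)$ by the normal closure of $\mathrm{Im}(\eta_{F_2})$. Then $\mathsf{CBau}(F_2)$ contains a subgroup that is a free group of countably infinite rank. In particular, the following assertion is false: ''for every localization $(L,\eta)$ on the category of groups and every group $G$, the cokernel of the homomorphism $\eta_G:G\to LG$ is abelian''.
   Context: A group $G$ is called uniquely divisible (or a $\mathbb{Q}$-group) if for every nonzero integer $n$ the map $G\to G$, $g\mapsto g^n$, is bijective. The Baumslag rationalization of a group $G$ is the universal homomorphism $\eta_G:G\to \mathsf{Bau}(G)$ to a uniquely divisible group: $\mathsf{Bau}(G)$ is uniquely divisible, and for every uniquely divisible group $H$ and every homomorphism $f:G\to H$ there is a unique homomorphism $\tilde f:\mathsf{Bau}(G)\to H$ with $\tilde f\circ\eta_G=f$. It exists for every group $G$ and defines a localization $(\mathsf{Bau},\eta)$ on the category of groups. A localization on a category $\mathcal{C}$ is a pair $(L,\eta)$, where $L:\mathcal{C}\to\mathcal{C}$ is a functor and $\eta:\mathsf{Id}\to L$ is a natural transformation such that the two natural transformations $\eta L, L\eta: L\to L^2$ are equal and are isomorphisms. The cokernel of a group homomorphism $f:H\to G$ is the quotient of $G$ by the normal closure of $\mathrm{Im}(f)$ in $G$. *)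

(* Defs.v *)
From HB Require Import structures.
From mathcomp Require Import all_boot ssralg ssrint.
From mathcomp Require Import boolp classical_sets.

Set Implicit Arguments.
Unset Strict Implicit.
Unset Printing Implicit Defensive.

Local Open Scope group_scope.

(* Groups are the (possibly infinite) [groupType]s. A group homomorphism is a
   [{multiplicative G -> H}]: between groups such a map preserves 1 and
   inverses. Homomorphisms are compared pointwise. *)

Definition is_group_iso (G H : groupType) (f : {multiplicative G -> H}) : Prop :=
  exists g : {multiplicative H -> G}, cancel f g /\ cancel g f.

Definition expgz (G : groupType) (g : G) (n : int) : G :=
  match n with
  | Posz k => g ^+ k
  | Negz k => g ^- k.+1
  end.

Definition uniquely_divisible (G : groupType) : Prop :=
  forall n : int, n <> 0%R -> bijective (fun g : G => expgz g n).

Definition is_baumslag_rationalization (G B : groupType)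
    (eta : {multiplicative G -> B}) : Prop :=
  uniquely_divisible B /\
  forall H : groupType, uniquely_divisible H ->
  forall f : {multiplicative G -> H},
  exists2 ft : {multiplicative B -> H},
    ft \o eta =1 f &
    forall ft' : {multiplicative B -> H}, ft' \o eta =1 f -> ft' =1 ft.

(* [F] is a free group with basis the family [b]; its rank is the
   cardinality of [X]. *)
Definition is_free_on (X : Type) (F : groupType) (b : X -> F) : Prop :=
  forall (H : groupType) (h : X -> H),
  exists2 f : {multiplicative F -> H},
    f \o b =1 h &
    forall f' : {multiplicative F -> H}, f' \o b =1 h -> f' =1 f.

Definition has_free_subgroup_of_countable_rank (G : groupType) : Prop :=
  exists (S : {pred G}) (K : subGroupType S) (b : nat -> K), is_free_on b.

Definition normal_subgroup (G : groupType) (N : set G) : Prop :=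
  [/\ N 1,
      forall x y, N x -> N y -> N (x * y),
      forall x, N x -> N x^-1 &
      forall x y, N x -> N (x ^ y)].

Definition normal_closure (G : groupType) (A : set G) : set G :=
  smallest (@normal_subgroup G) A.

Lemma normal_closure_normal (G : groupType) (A : set G) :
  normal_subgroup (normal_closure A).
Proof.
split.
- by move=> N [[]].
- by move=> x y hx hy N hN; case: (hN) => -[_ hM _ _] _; apply: hM; [exact: hx|exact: hy].
- by move=> x hx N hN; case: (hN) => -[_ _ hV _] _; apply: hV; exact: hx.
- by move=> x y hx N hN; case: (hN) => -[_ _ _ hJ] _; apply: hJ; exact: hx.
Qed.

Section Cokernel.
Variables (H G : groupType) (f : {multiplicative H -> G}).

Let N : set G := normal_closure (range f).
Let hN : normal_subgroup N := normal_closure_normal (range f).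

Definition coker_rel : rel G := fun x y => `[< N (x / y) >].

Lemma coker_rel_refl : reflexive coker_rel.
Proof. by move=> x; apply/asboolP; rewrite mulgV; case: hN. Qed.

Lemma coker_rel_sym : symmetric coker_rel.
Proof.
have [_ _ hV _] := hN.
suff sub x y : coker_rel x y -> coker_rel y x by move=> x y; apply/idP/idP; exact: sub.
by move=> /asboolP /hV; rewrite invgF => h; apply/asboolP.
Qed.

Lemma coker_rel_trans : transitive coker_rel.
Proof.
have [_ hM _ _] := hN.
move=> y x z /asboolP hxy /asboolP hyz; apply/asboolP.
by have := hM _ _ hxy hyz; rewrite mulgA mulgVK.
Qed.

Canonical coker_equiv : equiv_rel G :=
  EquivRel coker_rel coker_rel_refl coker_rel_sym coker_rel_trans.

Definition coker := {eq_quot coker_equiv}%qT.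
HB.instance Definition _ := EqQuotient.on coker.
HB.instance Definition _ := Choice.on coker.

Local Open Scope quotient_scope.

Lemma coker_eqP (x y : G) : \pi_coker x = \pi_coker y <-> N (x / y).
Proof. by split=> [/eqmodP /asboolP | h]; [|apply/eqmodP/asboolP]. Qed.

Lemma coker_relM (x x' y y' : G) :
  N (x / x') -> N (y / y') -> N ((x * y) / (x' * y')).
Proof.
have [_ hM _ hJ] := hN => hx hy.
have := hM _ _ (hJ _ x^-1 hy) hx.
by rewrite conjgE invgK invgM !mulgA mulgVK.
Qed.

Lemma coker_relV (x x' : G) : N (x / x') -> N (x^-1 / x'^-1).
Proof.
have [_ _ hV hJ] := hN => hx.
have := hJ _ x (hV _ hx).
by rewrite conjgE invgF invgK !mulgA mulgVK.
Qed.

Definition coker_one : coker := \pi_coker 1.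
Definition coker_mul (a b : coker) : coker := \pi_coker (repr a * repr b).
Definition coker_inv (a : coker) : coker := \pi_coker (repr a)^-1.

Lemma coker_reprP (x : G) : N (repr (\pi_coker x) / x).
Proof. by apply: (iffLR (coker_eqP _ _)); rewrite reprK. Qed.

Lemma coker_mul_pi (x y : G) :
  coker_mul (\pi_coker x) (\pi_coker y) = \pi_coker (x * y).
Proof. by apply: (iffRL (coker_eqP _ _)); apply: coker_relM; exact: coker_reprP. Qed.

Lemma coker_inv_pi (x : G) : coker_inv (\pi_coker x) = \pi_coker x^-1.
Proof. by apply: (iffRL (coker_eqP _ _)); apply: coker_relV; exact: coker_reprP. Qed.

Lemma coker_mulA : associative coker_mul.
Proof.
move=> a b c; rewrite -[a]reprK -[b]reprK -[c]reprK.
rewrite (coker_mul_pi (repr b) (repr c)) (coker_mul_pi (repr a) (repr b)).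
by rewrite coker_mul_pi coker_mul_pi mulgA.
Qed.
Lemma coker_mul1 : left_id coker_one coker_mul.
Proof. by move=> a; rewrite -[a]reprK (coker_mul_pi 1 (repr a)) mul1g. Qed.
Lemma coker_mulr1 : right_id coker_one coker_mul.
Proof. by move=> a; rewrite -[a]reprK (coker_mul_pi (repr a) 1) mulg1. Qed.
Lemma coker_mulV : left_inverse coker_one coker_inv coker_mul.
Proof. by move=> a; rewrite -[a]reprK coker_inv_pi (coker_mul_pi _ _) mulVg. Qed.
Lemma coker_mulrV : right_inverse coker_one coker_inv coker_mul.
Proof. by move=> a; rewrite -[a]reprK coker_inv_pi (coker_mul_pi _ _) mulgV. Qed.

HB.instance Definition _ :=
  isGroup.Build coker coker_mulA coker_mul1 coker_mulr1 coker_mulV coker_mulrV.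

Definition coker_proj (x : G) : coker := \pi_coker x.

Lemma coker_projM : {morph coker_proj : x y / x * y}.
Proof. by move=> x y; exact/esym/coker_mul_pi. Qed.

HB.instance Definition _ := isMultiplicative.Build G coker coker_proj coker_projM.

End Cokernel.

(* A localization on the category of groups. Since homomorphisms are compared
   pointwise, [loc_ext] says that [loc_map] is well defined; under function
   extensionality it is redundant. A natural transformation is an isomorphism
   when all its components are. *)
Record localization := Localization {
  loc_obj :> groupType -> groupType;
  loc_map : forall G H : groupType,
    {multiplicative G -> H} -> {multiplicative loc_obj G -> loc_obj H};
  loc_ext : forall (G H : groupType) (f g : {multiplicative G -> H}),
    f =1 g -> loc_map f =1 loc_map g;
  loc_id : forall G : groupType,
    loc_map (idfun : {multiplicative G -> G}) =1 idfun;
  loc_comp : forall (G H K : groupType)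
    (g : {multiplicative H -> K}) (f : {multiplicative G -> H}),
    loc_map (g \o f : {multiplicative G -> K}) =1 loc_map g \o loc_map f;
  loc_eta : forall G : groupType, {multiplicative G -> loc_obj G};
  loc_eta_natural : forall (G H : groupType) (f : {multiplicative G -> H}),
    loc_map f \o loc_eta G =1 loc_eta H \o f;
  loc_etaL_eq : forall G : groupType,
    loc_eta (loc_obj G) =1 loc_map (loc_eta G);
  loc_etaL_iso : forall G : groupType, is_group_iso (loc_eta (loc_obj G));
  loc_Leta_iso : forall G : groupType, is_group_iso (loc_map (loc_eta G))
}.

(* Main.v *)
From HB Require Import structures.
Require Import Defs.
From mathcomp Require Import all_boot all_order all_algebra all_field.
From mathcomp Require Import boolp classical_sets.
From mathcomp Require Import ring.

(* A uniquely divisible group E is built in which roots of two elements x and y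
   are prescribed modulo a normal subgroup containing x and y.

   For a valuation ring O of the algebraic numbers with maximal ideal m, the
   matrices of SU(2) congruent to 1 modulo m admit unique n-th roots for every n
   invertible modulo m: an eigenvalue z = 1 mod m has exactly one n-th root
   congruent to 1, and the n-th root of the matrix is a linear combination of the
   matrix and the identity. Take O_k over a prime p_k > k. The product of these
   groups modulo eventual equality is a uniquely divisible group E, and it maps
   to the group D of sequences in SU(2) modulo sequences tending to 1. Since
   T = p / (p + 1) is 0 modulo p and close to 1 for the absolute value, every
   element of finite order of SU(2) considered below is a limit of elements
   congruent to 1 modulo m_k. So there are x, y in E whose images in D are trivial,
   while the 3^(n+1)-th root of x has as image the diagonal rotation a_n by a
   primitive 3^(n+1)-th root of unity, and the fourth root of y has as image the
   quaternion b = (3 i + 4 j) / 5.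

   By the universal property, Bau(F_2) -> E -> D kills the image of F_2, hence
   factors through the cokernel, whose image contains c_n = a_n b a_n. The c_n
   are free generators: at a place over 5, the matrix 5 b has rank one and square
   0, and 5 b d 5 b is a unit multiple of 5 b for diagonal d = diag(z, 1/z) with
   z - 1/z a unit, so that no reduced word in the c_n is diagonal. *)

Set Implicit Arguments.
Unset Strict Implicit.
Unset Printing Implicit Defensive.

Import Order.TTheory GRing.Theory Num.Theory.

(** * Quotients, free groups and the rationalization functor *)

Local Open Scope group_scope.

Definition hom_of_morph (G H : groupType) (f : G -> H)
  (fM : {morph f : x y / x * y}) : {multiplicative G -> H} :=
  HB.pack f (isMultiplicative.Build G H f fM).

Section GroupHom.
Variables (G H : groupType) (f : {multiplicative G -> H}).

Lemma hom1 : f 1 = 1.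
Proof. by apply: (mulgI (f 1)); rewrite -gmulfM !mulg1. Qed.

Lemma homV x : f x^-1 = (f x)^-1.
Proof. by apply: (mulgI (f x)); rewrite -gmulfM !mulgV hom1. Qed.

Lemma homX x n : f (x ^+ n) = f x ^+ n.
Proof. by elim: n => [|n IH]; rewrite ?hom1// !expgS gmulfM IH. Qed.

End GroupHom.

(** Negative powers are positive powers followed by inversion, so exponents of the form [n.+1]
    suffice. *)
Lemma uniquely_divisibleP (G : groupType) :
  uniquely_divisible G <->
  forall n, (forall x y : G, x ^+ n.+1 = y ^+ n.+1 -> x = y) /\
            (forall g : G, exists h, h ^+ n.+1 = g).
Proof.
split=> [udG n | h].
  have [//|r xK rK] := udG (Posz n.+1).
  split=> [x y /= exy | g]; last by exists (r g); exact: rK.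
  by rewrite -[x]xK -[y]xK /= exy.
suff bij n : bijective (fun g : G => g ^+ n.+1).
  case=> [[|n]|n] // _; first exact: bij.
  by have := bij_comp (inv_bij (@invgK G)) (bij n); move=> /eq_bij; apply.
have [inj /choice[r rK]] := h n.
by exists r => [x|x]; [apply: inj|]; rewrite rK.
Qed.

(** A bare type with a group law up to [gs_rel]. Its quotient, taken with classical choice, yields
    four groups below: the free group, the rationalization and the two groups of sequences. *)
Record group_setoid := GroupSetoid {
  gs_car :> Type;
  gs_rel : gs_car -> gs_car -> Prop;
  gs_one : gs_car;
  gs_mul : gs_car -> gs_car -> gs_car;
  gs_inv : gs_car -> gs_car;
  gs_refl : forall x, gs_rel x x;
  gs_sym : forall x y, gs_rel x y -> gs_rel y x;
  gs_trans : forall x y z, gs_rel x y -> gs_rel y z -> gs_rel x z;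
  gs_mul_rel : forall x x' y y',
    gs_rel x x' -> gs_rel y y' -> gs_rel (gs_mul x y) (gs_mul x' y');
  gs_inv_rel : forall x x', gs_rel x x' -> gs_rel (gs_inv x) (gs_inv x');
  gs_mulA : forall x y z,
    gs_rel (gs_mul x (gs_mul y z)) (gs_mul (gs_mul x y) z);
  gs_mul1 : forall x, gs_rel (gs_mul gs_one x) x;
  gs_mulr1 : forall x, gs_rel (gs_mul x gs_one) x;
  gs_mulV : forall x, gs_rel (gs_mul (gs_inv x) x) gs_one;
  gs_mulrV : forall x, gs_rel (gs_mul x (gs_inv x)) gs_one
}.

Section QuotientGroup.
Variable S : group_setoid.

Definition gs_relb : rel {classic gs_car S} := fun x y => `[< gs_rel x y >].

Lemma gs_relb_refl : reflexive gs_relb.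
Proof. by move=> x; apply/asboolP; exact: gs_refl. Qed.

Lemma gs_relb_sym : symmetric gs_relb.
Proof. by move=> x y; apply/asboolP/asboolP; exact: gs_sym. Qed.

Lemma gs_relb_trans : transitive gs_relb.
Proof.
by move=> y x z /asboolP xy /asboolP yz; apply/asboolP; exact: gs_trans xy yz.
Qed.

Canonical gs_equiv : equiv_rel {classic gs_car S} :=
  EquivRel gs_relb gs_relb_refl gs_relb_sym gs_relb_trans.

Definition gquot := {eq_quot gs_equiv}%qT.
HB.instance Definition _ := EqQuotient.on gquot.
HB.instance Definition _ := Choice.on gquot.

Local Open Scope quotient_scope.

Definition gclass (x : S) : gquot := \pi_gquot (x : {classic gs_car S}).

Lemma gclassP (x y : S) : gclass x = gclass y <-> gs_rel x y.
Proof. by split=> [/eqmodP /asboolP | h]; [|apply/eqmodP/asboolP]. Qed.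

Lemma gclass_surj (a : gquot) : exists x, a = gclass x.
Proof. by exists (repr a); rewrite /gclass reprK. Qed.

Lemma gs_reprP (x : S) : gs_rel (repr (gclass x) : S) x.
Proof. by apply/gclassP; rewrite /gclass reprK. Qed.

Definition gq_mul (a b : gquot) : gquot := gclass (gs_mul (repr a : S) (repr b : S)).
Definition gq_inv (a : gquot) : gquot := gclass (gs_inv (repr a : S)).

Lemma gq_mul_class (x y : S) : gq_mul (gclass x) (gclass y) = gclass (gs_mul x y).
Proof. by apply/gclassP/gs_mul_rel; exact: gs_reprP. Qed.

Lemma gq_inv_class (x : S) : gq_inv (gclass x) = gclass (gs_inv x).
Proof. by apply/gclassP/gs_inv_rel; exact: gs_reprP. Qed.

Lemma gq_mulA : associative gq_mul.
Proof.
move=> a b c.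
have [x ->] := gclass_surj a; have [y ->] := gclass_surj b.
have [z ->] := gclass_surj c.
by rewrite !gq_mul_class; apply/gclassP; exact: gs_mulA.
Qed.

Lemma gq_mul1 : left_id (gclass (gs_one S)) gq_mul.
Proof.
move=> a; have [x ->] := gclass_surj a.
by rewrite gq_mul_class; apply/gclassP; exact: gs_mul1.
Qed.

Lemma gq_mulr1 : right_id (gclass (gs_one S)) gq_mul.
Proof.
move=> a; have [x ->] := gclass_surj a.
by rewrite gq_mul_class; apply/gclassP; exact: gs_mulr1.
Qed.

Lemma gq_mulV : left_inverse (gclass (gs_one S)) gq_inv gq_mul.
Proof.
move=> a; have [x ->] := gclass_surj a.
by rewrite gq_inv_class gq_mul_class; apply/gclassP; exact: gs_mulV.
Qed.

Lemma gq_mulrV : right_inverse (gclass (gs_one S)) gq_inv gq_mul.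
Proof.
move=> a; have [x ->] := gclass_surj a.
by rewrite gq_inv_class gq_mul_class; apply/gclassP; exact: gs_mulrV.
Qed.

HB.instance Definition _ :=
  isGroup.Build gquot gq_mulA gq_mul1 gq_mulr1 gq_mulV gq_mulrV.

Lemma gclass1 : gclass (gs_one S) = 1. Proof. by []. Qed.

Lemma gclassM (x y : S) : gclass (gs_mul x y) = gclass x * gclass y.
Proof. exact/esym/gq_mul_class. Qed.

Lemma gclassV (x : S) : gclass (gs_inv x) = (gclass x)^-1.
Proof. exact/esym/gq_inv_class. Qed.

Lemma gquot_lift (H : groupType) (f : S -> H) :
  (forall x y, gs_rel x y -> f x = f y) ->
  (forall x y, f (gs_mul x y) = f x * f y) ->
  exists phi : {multiplicative gquot -> H}, forall x, phi (gclass x) = f x.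
Proof.
move=> frel fM.
pose phi (a : gquot) := f (repr a : S).
have phiE x : phi (gclass x) = f x by apply: frel; exact: gs_reprP.
have phiM : {morph phi : a b / a * b}.
  move=> a b; have [x ->] := gclass_surj a; have [y ->] := gclass_surj b.
  by rewrite -gclassM !phiE fM.
by exists (hom_of_morph phiM).
Qed.

End QuotientGroup.

(** * Free groups as words modulo equality in every group *)

Section Words.
Variable X : Type.
Implicit Types (w : seq (X * bool)).

Definition letter_eval (H : groupType) (h : X -> H) (l : X * bool) : H :=
  if l.2 then h l.1 else (h l.1)^-1.

Definition word_eval (H : groupType) (h : X -> H) w : H :=
  \prod_(l <- w) letter_eval h l.

Definition word_inv w := rev [seq (l.1, ~~ l.2) | l <- w].

Lemma word_eval_cat (H : groupType) (h : X -> H) w w' :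
  word_eval h (w ++ w') = word_eval h w * word_eval h w'.
Proof. exact: big_cat. Qed.

Lemma word_eval1 (H : groupType) (h : X -> H) l :
  word_eval h [:: l] = letter_eval h l.
Proof. exact: big_seq1. Qed.

Lemma word_eval_cons (H : groupType) (h : X -> H) l w :
  word_eval h (l :: w) = letter_eval h l * word_eval h w.
Proof. exact: big_cons. Qed.

Lemma word_eval_inv (H : groupType) (h : X -> H) w :
  word_eval h (word_inv w) = (word_eval h w)^-1.
Proof.
elim: w => [|[x e] w IH]; first by rewrite /word_eval !big_nil invg1.
rewrite /word_inv /= rev_cons -cats1 word_eval_cat [X in X * _]IH.
rewrite word_eval1 word_eval_cons invgM; congr (_ * _).
by rewrite /letter_eval /=; case: e => //=; rewrite invgK.
Qed.

Lemma word_eval_hom (H H' : groupType) (f : {multiplicative H -> H'})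
  (h : X -> H) w : word_eval (f \o h) w = f (word_eval h w).
Proof.
elim: w => [|[x e] w IH]; first by rewrite /word_eval !big_nil hom1.
rewrite !word_eval_cons IH gmulfM; congr (_ * _).
by rewrite /letter_eval; case: e => //=; rewrite homV.
Qed.

Lemma eq_word_eval (H : groupType) (h h' : X -> H) w :
  h =1 h' -> word_eval h w = word_eval h' w.
Proof. by move=> e; apply: eq_bigr => l _; rewrite /letter_eval e. Qed.

(** Words are identified when they agree in every group under every assignment, which makes
    evaluation well defined by construction. *)
Definition free_setoid : group_setoid.
Proof.
refine (@GroupSetoid (seq (X * bool))
  (fun w w' => forall (H : groupType) (h : X -> H),
     word_eval h w = word_eval h w')
  [::] cat word_inv _ _ _ _ _ _ _ _ _ _).
- by [].
- by move=> w w' e H h.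
- by move=> w1 w2 w3 e1 e2 H h; rewrite e1.
- by move=> w1 w2 w3 w4 e1 e2 H h; rewrite !word_eval_cat e1 e2.
- by move=> w1 w2 e H h; rewrite !word_eval_inv e.
- by move=> w1 w2 w3 H h; rewrite catA.
- by [].
- by move=> w H h; rewrite cats0.
- by move=> w H h; rewrite word_eval_cat word_eval_inv mulVg /word_eval big_nil.
- by move=> w H h; rewrite word_eval_cat word_eval_inv mulgV /word_eval big_nil.
Defined.

Definition free_group : groupType := gquot free_setoid.
Definition free_gen (x : X) : free_group :=
  @gclass free_setoid [:: (x, true)].

Lemma free_word_eval w : word_eval free_gen w = @gclass free_setoid w.
Proof.
elim: w => [|[x e] w IH]; first by rewrite /word_eval big_nil -gclass1.
rewrite -cat1s word_eval_cat IH.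
have -> : word_eval free_gen [:: (x, e)] = @gclass free_setoid [:: (x, e)].
  rewrite /word_eval big_seq1 /letter_eval /=; case: e => //.
  by rewrite -gclassV.
by rewrite -gclassM.
Qed.

Lemma free_groupP : is_free_on free_gen.
Proof.
move=> H h.
have [||f fE] := @gquot_lift free_setoid H (word_eval h).
- by move=> w w'; exact.
- by move=> w w'; exact: word_eval_cat.
exists f => [x|f' f'E g].
  by rewrite /= fE /word_eval big_seq1.
have [w ->] := gclass_surj g.
by rewrite fE -free_word_eval -word_eval_hom; exact: eq_word_eval.
Qed.

End Words.

(** * Free subgroups from families without nontrivial reduced relations *)

Section FreeSubgroup.
Variables (X : eqType) (G : groupType) (c : X -> G).

(** [sorted no_cancel w] expresses that the word w is reduced. *)
Definition no_cancel (l l' : X * bool) : bool :=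
  ~~ ((l.1 == l'.1) && (l.2 != l'.2)).

Lemma reduce_word (w : seq (X * bool)) :
  exists2 w', sorted no_cancel w' &
    forall (H : groupType) (h : X -> H), word_eval h w = word_eval h w'.
Proof.
elim: w => [|l w [w' red_w' ew]]; first by exists [::].
have ewl (H : groupType) (h : X -> H) : word_eval h (l :: w) = word_eval h (l :: w').
  by rewrite !word_eval_cons ew.
case: w' red_w' ew ewl => [|l' w'] red_w' ew ewl.
  by exists [:: l].
case nc: (no_cancel l l').
  by exists (l :: l' :: w'); [rewrite /= nc|exact: ewl].
exists w' => [|H h]; first exact: path_sorted red_w'.
rewrite ewl /word_eval !big_cons mulgA.
move: nc; rewrite /no_cancel /letter_eval.
case: l l' {red_w' ew ewl} => [x e] [x' e'] /= /negbFE/andP[/eqP -> ee'].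
suff -> : (if e then h x' else (h x')^-1) * (if e' then h x' else (h x')^-1) = 1.
  by rewrite mul1g.
by case: e e' ee' => -[] //= _; rewrite ?mulgV ?mulVg.
Qed.

Hypothesis free_c :
  forall w, sorted no_cancel w -> word_eval c w = 1 -> w = [::].

Definition generated_pred : {pred G} := fun g => `[< exists w, word_eval c w = g >].

Lemma generated_closed : group_closed generated_pred.
Proof.
split; first by apply/asboolP; exists [::]; rewrite /word_eval big_nil.
move=> _ _ /asboolP[w <-] /asboolP[w' <-]; apply/asboolP.
by exists (w ++ word_inv w'); rewrite word_eval_cat word_eval_inv.
Qed.

Definition generated := {g : G | generated_pred g}.
HB.instance Definition _ := SubChoice.on generated.
HB.instance Definition _ :=
  SubChoice_isSubGroup.Build G generated_pred generated generated_closed.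

Lemma generated_gen x : generated_pred (c x).
Proof. by apply/asboolP; exists [:: (x, true)]; rewrite /word_eval big_seq1. Qed.

Definition generated_basis (x : X) : generated := exist _ (c x) (generated_gen x).

(** Reducing w w'^-1 gives a reduced word that is trivial at c, hence empty by [free_c]; so w and w'
    agree in every group. *)
Lemma free_word_eval_eq (H : groupType) (h : X -> H) w w' :
  word_eval c w = word_eval c w' -> word_eval h w = word_eval h w'.
Proof.
move=> e; have [w2 red2 ew2] := reduce_word (w ++ word_inv w').
have : word_eval c w2 = 1 by rewrite -ew2 word_eval_cat word_eval_inv e mulgV.
move=> /(free_c red2) w20; apply: (mulIg (word_eval h w')^-1).
by rewrite mulgV -word_eval_inv -word_eval_cat ew2 w20 /word_eval big_nil.
Qed.

Lemma generated_free : is_free_on generated_basis.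
Proof.
move=> H h.
have wordP (g : generated) : exists w, word_eval c w = val g.
  exact/asboolP/(valP g).
(* A word is chosen for every element; by [free_word_eval_eq] its value under h does not depend on
   the choice. *)
have [f fE] := choice wordP.
have hM : {morph (fun g : generated => word_eval h (f g)) : g g' / g * g'}.
  move=> g g'; rewrite -word_eval_cat; apply: free_word_eval_eq.
  by rewrite word_eval_cat !fE valM.
exists (hom_of_morph hM) => [x|f' f'E g] /=.
  rewrite -[RHS](_ : word_eval h [:: (x, true)] = h x); last first.
    by rewrite /word_eval big_seq1.
  by apply: free_word_eval_eq; rewrite fE /word_eval big_seq1.
have gE : g = word_eval generated_basis (f g).
  apply: val_inj; rewrite -[LHS]fE.
  by rewrite -(@word_eval_hom _ _ _ (val : {multiplicative generated -> G})).
by rewrite {1}gE -word_eval_hom; exact: eq_word_eval.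
Qed.

End FreeSubgroup.

Lemma free_subgroup_of_countable_rank (G : groupType) (c : nat -> G) :
  (forall w, sorted (@no_cancel nat) w -> word_eval c w = 1 -> w = [::]) ->
  has_free_subgroup_of_countable_rank G.
Proof.
by move=> hc; exists (generated_pred c), (generated c), (generated_basis c); exact: generated_free.
Qed.

Lemma free_not_commutative (X : eqType) (G : groupType) (c : X -> G) (x y : X) :
  (forall w, sorted (@no_cancel X) w -> word_eval c w = 1 -> w = [::]) ->
  x != y -> c x * c y <> c y * c x.
Proof.
move=> free_c xy cxy.
(* The commutator of x and y is a reduced word because x and y differ. *)
pose w := [:: (x, true); (y, true); (x, false); (y, false)].
suff /(free_c w) : word_eval c w = 1.
  by rewrite /w /= /no_cancel /= (negPf xy) (eq_sym y) (negPf xy) => /(_ isT).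
rewrite /w /word_eval !big_cons big_nil mulg1 /letter_eval /=.
by rewrite !mulgA cxy mulgK mulgV.
Qed.

(** * The Baumslag rationalization as classes of terms with roots *)

Inductive root_term (X : Type) : Type :=
| RVar of X | ROne | RMul of root_term X & root_term X
| RInv of root_term X | RRoot of nat & root_term X.
Arguments ROne {X}.

(* [RRoot n t] stands for the root of index [n.+1]. *)
Fixpoint root_eval (X : Type) (H : groupType) (h : X -> H) (t : root_term X) : H :=
  match t with
  | RVar x => h x
  | ROne => 1
  | RMul t1 t2 => root_eval h t1 * root_eval h t2
  | RInv t1 => (root_eval h t1)^-1
  | RRoot n t1 => xget 1 [set g | g ^+ n.+1 = root_eval h t1]%classic
  end.

(** [xget] returns its default 1 only when no root exists, which unique divisibility excludes. *)
Lemma root_evalX (X : Type) (H : groupType) (h : X -> H) n t :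
  uniquely_divisible H -> root_eval h (RRoot n t) ^+ n.+1 = root_eval h t.
Proof.
move=> /uniquely_divisibleP/(_ n)[_ /(_ (root_eval h t)) ex].
exact: (xgetPex 1 ex).
Qed.

Section Baumslag.
Variable G : groupType.

(* Two terms are identified when they agree in every uniquely divisible group
   under G; the quantification over all such groups is impredicative in [Prop]. *)
Definition baumslag_setoid : group_setoid.
Proof.
refine (@GroupSetoid (root_term G)
  (fun t t' => forall (H : groupType) (f : {multiplicative G -> H}),
     uniquely_divisible H -> root_eval f t = root_eval f t')
  ROne (@RMul G) (@RInv G) _ _ _ _ _ _ _ _ _ _).
- by [].
- by move=> t t' e H f udH; rewrite e.
- by move=> t1 t2 t3 e1 e2 H f udH; rewrite e1// e2.
- by move=> t1 t2 t3 t4 e1 e2 H f udH /=; rewrite e1// e2.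
- by move=> t1 t2 e H f udH /=; rewrite e.
- by move=> t1 t2 t3 H f udH /=; rewrite mulgA.
- by move=> t H f udH /=; rewrite mul1g.
- by move=> t H f udH /=; rewrite mulg1.
- by move=> t H f udH /=; rewrite mulVg.
- by move=> t H f udH /=; rewrite mulgV.
Defined.

Definition baumslag : groupType := gquot baumslag_setoid.

Let cl (t : root_term G) : baumslag := @gclass baumslag_setoid t.

Lemma baumslag_etaM : {morph (fun g : G => cl (RVar g)) : x y / x * y}.
Proof.
move=> x y; rewrite /cl -gclassM; apply/gclassP => H f udH /=.
by rewrite gmulfM.
Qed.

Definition baumslag_eta : {multiplicative G -> baumslag} :=
  hom_of_morph baumslag_etaM.

Lemma baumslag_classX n t : exists2 u : root_term G,
  cl t ^+ n = cl u &
  forall (H : groupType) (f : {multiplicative G -> H}),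
    root_eval f u = root_eval f t ^+ n.
Proof.
elim: n => [|n [u ut uE]]; first by exists ROne => //; rewrite -gclass1.
exists (RMul t u) => [|H f /=]; last by rewrite uE expgS.
by rewrite expgS ut /cl -gclassM.
Qed.

Lemma baumslag_root n t : cl (RRoot n t) ^+ n.+1 = cl t.
Proof.
have [u -> uE] := baumslag_classX n.+1 (RRoot n t).
by apply/gclassP => H f udH; rewrite uE root_evalX.
Qed.

(** Roots exist by the constructor [RRoot]; they are unique because terms are compared only in
    uniquely divisible groups. *)
Lemma baumslag_uniquely_divisible : uniquely_divisible baumslag.
Proof.
apply/uniquely_divisibleP => n; split=> [x y|g]; last first.
  by have [t ->] := gclass_surj g; exists (cl (RRoot n t)); exact: baumslag_root.
have [t ->] := gclass_surj x; have [t' ->] := gclass_surj y.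
have [u ut uE] := baumslag_classX n.+1 t.
have [u' ut' uE'] := baumslag_classX n.+1 t'.
move=> e; apply/gclassP => H f udH.
have : @gclass baumslag_setoid u = @gclass baumslag_setoid u'.
  by rewrite -[LHS]ut -[RHS]ut'.
move=> /gclassP /(_ H f udH); rewrite uE uE'.
by have /uniquely_divisibleP/(_ n)[+ _] := udH; apply.
Qed.

Lemma baumslagP : is_baumslag_rationalization baumslag_eta.
Proof.
split=> [|H udH f]; first exact: baumslag_uniquely_divisible.
have [||ft ftE] := @gquot_lift baumslag_setoid H (root_eval f).
- by move=> t t'; exact.
- by [].
exists ft => [g|f' f'E g] /=; first by rewrite ftE.
have [t ->] := gclass_surj g; rewrite ftE; elim: t => /=.
- by move=> x; exact: f'E.
- by rewrite gclass1 hom1.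
- by move=> t1 e1 t2 e2; rewrite gclassM gmulfM e1 e2.
- by move=> t1 e1; rewrite gclassV homV e1.
(* The image of a root is a root of the image, and roots in H are unique. *)
- move=> n t e; have [_ /(_ _)] := (iffLR (uniquely_divisibleP H) udH) n.
  have /uniquely_divisibleP/(_ n)[inj _] := udH => _.
  apply: inj; rewrite -homX baumslag_root e.
  by rewrite -[LHS](root_evalX f n t udH).
Qed.

End Baumslag.

(** * The localization defined by the rationalization *)

Section BaumslagFunctor.

Lemma rationalization_hom_eq (G B H : groupType) (eta : {multiplicative G -> B})
  (f f' : {multiplicative B -> H}) :
  is_baumslag_rationalization eta -> uniquely_divisible H ->
  f \o eta =1 f' \o eta -> f =1 f'.
Proof.
move=> [_ univ] udH e.
have [ft _ uniq] := univ H udH (f \o eta : {multiplicative G -> H}).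
by move=> x; rewrite (uniq f)// (uniq f')// => y; rewrite -e.
Qed.

(** The identity of B extends to a map g on B'; then eta g and the identity agree on the image of
    eta, hence everywhere. *)
Lemma rationalization_self (B B' : groupType) (eta : {multiplicative B -> B'}) :
  is_baumslag_rationalization eta -> uniquely_divisible B -> is_group_iso eta.
Proof.
move=> ratB udB; have [udB' univ] := ratB.
have [g gK _] := univ B udB (idfun : {multiplicative B -> B}).
exists g; split=> // x.
apply: (rationalization_hom_eq (f := eta \o g : {multiplicative B' -> B'})
  (f' := idfun : {multiplicative B' -> B'}) ratB udB') => y /=.
by have /= -> := gK y.
Qed.

Lemma baumslag_map_ex (G H : groupType) (f : {multiplicative G -> H}) :
  exists phi : {multiplicative baumslag G -> baumslag H},
    phi \o baumslag_eta G =1 baumslag_eta H \o f.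
Proof.
have [_ univ] := baumslagP G.
have [phi phiE _] := univ _ (baumslag_uniquely_divisible H)
  (baumslag_eta H \o f : {multiplicative G -> baumslag H}).
by exists phi.
Qed.

Definition baumslag_map (G H : groupType) (f : {multiplicative G -> H}) :
  {multiplicative baumslag G -> baumslag H} := projT1 (cid (baumslag_map_ex f)).

Lemma baumslag_mapE (G H : groupType) (f : {multiplicative G -> H}) :
  baumslag_map f \o baumslag_eta G =1 baumslag_eta H \o f.
Proof. exact: projT2 (cid (baumslag_map_ex f)). Qed.

Lemma baumslag_map_uniq (G H : groupType) (f : {multiplicative G -> H})
  (phi : {multiplicative baumslag G -> baumslag H}) :
  phi \o baumslag_eta G =1 baumslag_eta H \o f -> baumslag_map f =1 phi.
Proof.
move=> e; apply: (rationalization_hom_eq (baumslagP G)).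
  exact: baumslag_uniquely_divisible.
by move=> x; rewrite baumslag_mapE e.
Qed.

Lemma baumslag_etaL (G : groupType) :
  baumslag_map (baumslag_eta G) =1 baumslag_eta (baumslag G).
Proof. by apply: baumslag_map_uniq. Qed.

Lemma baumslag_eta_iso (G : groupType) : is_group_iso (baumslag_eta (baumslag G)).
Proof.
by apply: rationalization_self; [exact: baumslagP|exact: baumslag_uniquely_divisible].
Qed.

Definition baumslag_localization : localization.
Proof.
refine (@Localization baumslag baumslag_map _ _ _ baumslag_eta _ _ _ _).
- by move=> G H f g fg; apply: baumslag_map_uniq => x /=; rewrite fg -[RHS](baumslag_mapE g).
- by move=> G; apply: (baumslag_map_uniq (phi := idfun : {multiplicative _ -> _})).
- move=> G H K g f.
  apply: (baumslag_map_uniq (phi := baumslag_map g \o baumslag_map f : {multiplicative _ -> _})).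
  move=> x /=; rewrite -[RHS](baumslag_mapE g).
  by rewrite -[LHS](congr1 (baumslag_map g) (esym (baumslag_mapE f x))).
- exact: baumslag_mapE.
- by move=> G x; rewrite baumslag_etaL.
- exact: baumslag_eta_iso.
- move=> G; have [g [gK Kg]] := baumslag_eta_iso G.
  by exists g; split=> x; rewrite baumslag_etaL.
Defined.

End BaumslagFunctor.

(** * Valuation rings *)

Local Close Scope group_scope.
Local Open Scope classical_set_scope.
Local Open Scope ring_scope.

Definition subring_set (F : fieldType) (O : set F) : Prop :=
  [/\ O 1, forall x y, O x -> O y -> O (x - y) &
      forall x y, O x -> O y -> O (x * y)].

Definition valuation_ring (F : fieldType) (O : set F) : Prop :=
  subring_set O /\ forall z, O z \/ O z^-1.

(* [z = 0] is singled out because of the convention [0^-1 = 0]. *)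
Definition maximal_ideal (F : fieldType) (O : set F) : set F :=
  [set z | O z /\ (O z^-1 -> z = 0)].

Section SubringSet.
Variables (F : fieldType) (O : set F).
Hypothesis hO : subring_set O.

Lemma subring_set1 : O 1. Proof. by case: hO. Qed.
Lemma subring_setB x y : O x -> O y -> O (x - y). Proof. by case: hO => _ h _; exact: h. Qed.
Lemma subring_setM x y : O x -> O y -> O (x * y). Proof. by case: hO => _ _; exact. Qed.
Lemma subring_set0 : O 0.
Proof. by rewrite -(subrr 1); apply: subring_setB; exact: subring_set1. Qed.
Lemma subring_setN x : O x -> O (- x).
Proof. by rewrite -sub0r; apply: subring_setB; exact: subring_set0. Qed.
Lemma subring_setD x y : O x -> O y -> O (x + y).
Proof. by move=> hx hy; rewrite -[y]opprK; apply: subring_setB => //; exact: subring_setN. Qed.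
Lemma subring_setX n x : O x -> O (x ^+ n).
Proof.
move=> hx; elim: n => [|n IH]; first exact: subring_set1.
by rewrite exprS; apply: subring_setM.
Qed.
Lemma subring_set_nat n : O n%:R.
Proof.
elim: n => [|n IH]; first exact: subring_set0.
by rewrite -natr1; apply: subring_setD => //; exact: subring_set1.
Qed.
Lemma subring_set_sum I (r : seq I) (P : pred I) (E : I -> F) :
  (forall i, P i -> O (E i)) -> O (\sum_(i <- r | P i) E i).
Proof.
by move=> hE; apply: big_ind => //; [exact: subring_set0|exact: subring_setD].
Qed.

Definition adjoin (z : F) : set F :=
  [set y | exists2 f : {poly F}, (forall i, O f`_i) & y = f.[z]].

Lemma adjoin_subring z : subring_set (adjoin z).
Proof.
split.
- by exists 1; rewrite ?hornerC// => i; rewrite coef1; exact: subring_set_nat.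
- move=> _ _ [f hf ->] [g hg ->]; exists (f - g); last by rewrite !hornerE.
  by move=> i; rewrite coefB; exact: subring_setB.
- move=> _ _ [f hf ->] [g hg ->]; exists (f * g); last by rewrite !hornerE.
  by move=> i; rewrite coefM; apply: subring_set_sum => j _; exact: subring_setM.
Qed.

Lemma adjoin_sub z : O `<=` adjoin z.
Proof.
move=> x hx; exists x%:P; rewrite ?hornerC// => i.
by rewrite coefC; case: eqP => // _; exact: subring_set0.
Qed.

Lemma adjoin_mem z : adjoin z z.
Proof. by exists 'X; rewrite ?hornerX// => i; rewrite coefX; exact: subring_set_nat. Qed.

End SubringSet.

(** * Subrings maximal for not containing a^-1 *)

Section MaximalSubring.
Variables (F : fieldType) (O : set F) (a : F).
Hypotheses (hO : subring_set O) (Oa : O a) (a0 : a != 0) (Oa' : ~ O a^-1).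
Hypothesis maxO : forall B, subring_set B -> O `<=` B -> ~ B a^-1 -> B `<=` O.

Lemma maximal_adjoin z : ~ O z -> adjoin O z a^-1.
Proof.
move=> hz; apply: contrapT => h; apply: hz.
by apply: (maxO (adjoin_subring hO z) (adjoin_sub hO z) h); exact: adjoin_mem.
Qed.

(** If u = 1 - a b had no inverse in O, then a^-1 = f(u^-1) for some f over O. With N = size f and
    u^N = 1 - a c, c in O, the element a^-1 = u^N f(u^-1) + c would lie in O. *)
Lemma maximal_unit b : O b -> 1 - a * b != 0 /\ O (1 - a * b)^-1.
Proof.
move=> hb; set u := 1 - a * b.
have Ou : O u by apply: subring_setB => //; [exact: subring_set1|exact: subring_setM].
have u0 : u != 0.
  apply: contra_notN Oa' => /eqP /subr0_eq ab.
  by have <- : b = a^-1 by apply: (mulfI a0); rewrite mulfV.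
split=> //; apply: contrapT => /maximal_adjoin[f hf af].
apply: Oa'.
have [c hc uc] : exists2 c, O c & u ^+ size f = 1 - a * c.
  elim: (size f) => [|n [c hc IH]].
    by exists 0; rewrite ?mulr0 ?subr0//; exact: subring_set0.
  exists (b + c - a * b * c); last by rewrite exprS IH /u; ring.
  by apply: subring_setB => //; [exact: subring_setD|do 2?[apply: subring_setM => //]].
have -> : a^-1 = u ^+ size f * f.[u^-1] + c.
  by rewrite -af uc; field.
apply: subring_setD => //; rewrite horner_coef mulr_sumr.
apply: subring_set_sum => // i _; rewrite mulrCA; apply: subring_setM => //.
rewrite exprVn -expfB//.
exact: subring_setX.
Qed.

(** Induction on the total size. After exchanging z and z^-1, f is at least as long as g; since 1 -
    a g_0 is a unit, the relation for g rewrites the leading term of f in lower powers of z. *)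
Lemma maximal_relations z (f g : {poly F}) : z != 0 ->
  (forall i, O f`_i) -> (forall i, O g`_i) ->
  a * f.[z] = 1 -> a * g.[z^-1] = 1 -> False.
Proof.
have [n] := ubnP (size f + size g).
elim: n z f g => // n IH z f g; wlog le_gf : z f g / (size g <= size f)%N.
  move=> W; case: (leqP (size g) (size f)) => [le|/ltnW le]; first exact: W.
  move=> sz z0 hf hg ef eg; apply: (W z^-1 g f) => //; rewrite ?invrK ?invr_eq0//.
  by rewrite addnC.
move=> sz z0 hf hg ef eg.
case sf: (size f) => [|N].
  by move: ef => /eqP; rewrite horner_coef sf big_ord0 mulr0 eq_sym oner_eq0.
have [u0 Ou] := maximal_unit (hg 0%N); set u := 1 - _ in u0 Ou.
have ug : a * \sum_(j < N) g`_j.+1 * z^-1 ^+ j.+1 = u.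
  rewrite /u -eg (@horner_coef_wide _ N.+1); last by rewrite -sf.
  rewrite big_ord_recl mulrDr.
  by rewrite expr0 mulr1 [RHS]addrC addKr.
(* The leading term f_N z^N is written f_N u^-1 z^N u and the sum [ug] is substituted for the last
   u; its term in g_(N - i) lands in degree i. *)
pose h := \poly_(i < N) (f`_i + a * u^-1 * f`_N * g`_(N - i)).
apply: (IH z h g) => //.
- rewrite sf addSn ltnS in sz; apply: leq_ltn_trans sz.
  by rewrite leq_add2r size_poly.
- move=> i; rewrite coef_poly; case: ifP => _; last exact: subring_set0.
  by apply: subring_setD => //; do 3?[apply: subring_setM => //].
rewrite -{}ef horner_poly horner_coef sf big_ord_recr /=; congr (a * _).
under eq_bigr do rewrite mulrDl.
rewrite big_split /=; congr (_ + _).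
have -> : f`_N * z ^+ N = f`_N * u^-1 * z ^+ N * u by rewrite mulrAC divfK.
rewrite -[X in _ = _ * X]ug mulrCA !mulr_sumr (reindex_inj rev_ord_inj) /=.
apply: eq_bigr => i _; rewrite subKn// exprVn.
have -> : z ^+ N = z ^+ (N - i.+1) * z ^+ i.+1 by rewrite -exprD subnK.
by field; rewrite u0 expf_neq0.
Qed.

(** If z and z^-1 were both outside O, adjoining either one would produce a^-1, which gives the two
    relations excluded above. *)
Lemma maximal_valuation_ring : valuation_ring O.
Proof.
split=> // z; apply: contrapT => /not_orP[hz hz'].
have z0 : z != 0 by apply: contra_notN hz => /eqP ->; exact: subring_set0.
have [f hf ef] := maximal_adjoin hz; have [g hg eg] := maximal_adjoin hz'.
by apply: (maximal_relations z0 hf hg); rewrite -?ef -?eg mulfV.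
Qed.

End MaximalSubring.

(* Chevalley's extension theorem: a subring containing A and maximal for not
   containing a^-1 is a valuation ring. *)
Lemma exists_valuation_ring (F : fieldType) (A : set F) (a : F) :
  subring_set A -> A a -> a != 0 -> ~ A a^-1 ->
  exists O, [/\ valuation_ring O, A `<=` O & maximal_ideal O a].
Proof.
move=> hA Aa a0 Aa'.
pose P (B : set F) := B = set0 \/ [/\ subring_set B, A `<=` B & ~ B a^-1].
have [|O [PO maxO]] := @Zorn_bigcup F P.
  move=> C CP totC.
  have [[B0 [CB0 [hB0 AB0 B0a]]]|noB] :=
      pselect (exists B, C B /\ [/\ subring_set B, A `<=` B & ~ B a^-1]); last first.
    left; apply/seteqP; split=> // x [B CB Bx].
    have [B0|hB] := CP _ CB; first by rewrite B0 in Bx.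
    by case: noB; exists B.
  have sub B : C B -> forall x, B x -> [/\ subring_set B, A `<=` B & ~ B a^-1].
    by move=> CB x Bx; have [B0'|//] := CP _ CB; rewrite B0' in Bx.
  have two x y : (\bigcup_(X in C) X) x -> (\bigcup_(X in C) X) y ->
      exists B, [/\ C B, subring_set B, B x & B y].
    move=> [B1 CB1 B1x] [B2 CB2 B2y].
    have [s12|s21] := totC _ _ CB1 CB2.
      by exists B2; have [hB _ _] := sub _ CB2 _ B2y; split=> //; exact: s12.
    by exists B1; have [hB _ _] := sub _ CB1 _ B1x; split=> //; exact: s21.
  right; split.
  - split; first by exists B0 => //; exact: subring_set1.
      move=> x y /two h /h[B [CB hB Bx By]].
      by exists B => //; exact: subring_setB.
    move=> x y /two h /h[B [CB hB Bx By]].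
    by exists B => //; exact: subring_setM.
  - by move=> x Ax; exists B0 => //; exact: AB0.
  - by move=> [B CB Ba]; have [_ _] := sub _ CB _ Ba; exact.
have {PO} [O0|[hO AO Oa']] := PO.
  exfalso; apply: (maxO A); last by right; split.
  by rewrite O0; split=> // /(_ _ Aa).
exists O; split=> //.
  apply: (maximal_valuation_ring hO (AO _ Aa) a0 Oa') => B hB OB Ba.
  apply: contrapT => BO; apply: (maxO B) => //.
  by right; split=> // x /AO /OB.
by split; [exact: AO|].
Qed.

(** * Congruences modulo the maximal ideal of a valuation ring *)

Section ValuationRing.
Variables (F : fieldType) (O : set F).
Hypothesis vO : valuation_ring O.
Let hO : subring_set O := proj1 vO.
Let m := maximal_ideal O.

Lemma maximal_ideal_sub x : m x -> O x. Proof. by case. Qed.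

Lemma valuation_inv x : O x -> ~ m x -> O x^-1.
Proof. by move=> hx hm; apply: contrapT => h; apply: hm; split. Qed.

Lemma valuation_invN x : ~ O x -> m x^-1.
Proof. by move=> hx; case: (proj2 vO x) => // h; split=> //; rewrite invrK. Qed.

Lemma maximal_ideal0 : m 0.
Proof. by split=> //; exact: subring_set0. Qed.

Lemma maximal_ideal1 : ~ m 1.
Proof. by case=> h; rewrite invr1 => /(_ h) /eqP; rewrite oner_eq0. Qed.

Lemma maximal_idealM x y : O x -> m y -> m (x * y).
Proof.
move=> hx [hy my]; split; first exact: subring_setM.
rewrite invfM => h; have [->|x0] := eqVneq x 0; first by rewrite mul0r.
by rewrite my ?mulr0// -(mulVKf x0 y^-1); apply: subring_setM.
Qed.

Lemma maximal_idealN x : m x -> m (- x).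
Proof.
move=> h; rewrite -mulN1r; apply: maximal_idealM => //.
by apply: subring_setN => //; exact: subring_set1.
Qed.

(** One of y / x and x / y lies in O, so the sum is an O-multiple of x or of y. *)
Lemma maximal_idealD x y : m x -> m y -> m (x + y).
Proof.
wlog : x y / O (y / x).
  move=> W mx my; case: (proj2 vO (y / x)) => h; first exact: W.
  by rewrite addrC; apply: W => //; rewrite -invf_div.
move=> h mx my; have [x0|x0] := eqVneq x 0; first by rewrite x0 add0r.
have -> : x + y = (1 + y / x) * x by rewrite mulrDl mul1r divfK.
apply: maximal_idealM => //; apply: subring_setD => //; exact: subring_set1.
Qed.

Lemma maximal_idealB x y : m x -> m y -> m (x - y).
Proof. by move=> hx hy; apply: maximal_idealD => //; exact: maximal_idealN. Qed.

Lemma maximal_ideal_prime x y : O x -> m (x * y) -> m x \/ m y.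
Proof.
move=> hx hxy; have [mx|mx] := pselect (m x); [by left|right].
have x0 : x != 0 by apply: contra_notN mx => /eqP ->; exact: maximal_ideal0.
by rewrite -(mulKf x0 y); apply: maximal_idealM => //; exact: valuation_inv.
Qed.

Lemma maximal_idealX n x : O x -> m (x ^+ n) -> m x.
Proof.
move=> hx; elim: n => [/maximal_ideal1 //|n IH]; rewrite exprS.
by move=> /(maximal_ideal_prime hx) [].
Qed.

Lemma maximal_ideal_prod (I : eqType) (r : seq I) (E : I -> F) :
  {in r, forall i, O (E i)} -> m (\prod_(i <- r) E i) ->
  exists2 i, i \in r & m (E i).
Proof.
elim: r => [_|i r IH hE]; first by rewrite big_nil => /maximal_ideal1.
rewrite big_cons => /(maximal_ideal_prime (hE i (mem_head i r)))[h|].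
  by exists i; rewrite ?mem_head.
move=> /IH[j jr|j jr mj]; first by apply: hE; rewrite inE jr orbT.
by exists j; rewrite // inE jr orbT.
Qed.

Lemma congr1_mem x : m (x - 1) -> O x.
Proof.
move=> h; rewrite -(subrK 1 x); apply: subring_setD => //.
  exact: maximal_ideal_sub.
exact: subring_set1.
Qed.

Lemma congr1_notin x : m (x - 1) -> ~ m x.
Proof.
by move=> h hx; apply: maximal_ideal1; have := maximal_idealB hx h; rewrite subKr.
Qed.

Lemma congr1M x y : m (x - 1) -> m (y - 1) -> m (x * y - 1).
Proof.
move=> hx hy; have -> : x * y - 1 = x * (y - 1) + (x - 1) by ring.
by apply: maximal_idealD => //; apply: maximal_idealM => //; exact: congr1_mem.
Qed.

Lemma congr1V x : m (x - 1) -> m (x^-1 - 1).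
Proof.
move=> hx; have x0 : x != 0.
  by apply: contra_notN (congr1_notin hx) => /eqP ->; exact: maximal_ideal0.
have -> : x^-1 - 1 = - x^-1 * (x - 1) by field.
apply: maximal_idealM => //; apply: subring_setN => //.
by apply: valuation_inv; [exact: congr1_mem|exact: congr1_notin].
Qed.

Lemma congr1X n x : m (x - 1) -> m (x ^+ n - 1).
Proof.
move=> hx; elim: n => [|n IH]; first by rewrite subrr; exact: maximal_ideal0.
by rewrite exprS; exact: congr1M.
Qed.

(** Valuation rings are integrally closed: if x is not in O then x^-1 is, and x = x^n (x^-1)^(n -
    1). *)
Lemma valuation_root n x : (0 < n)%N -> O (x ^+ n) -> O x.
Proof.
case: n => // n _ h; apply: contrapT => hx.
have mx := valuation_invN hx.
have x0 : x != 0 by apply: contra_notN hx => /eqP ->; exact: subring_set0.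
apply: hx; have -> : x = x ^+ n.+1 * x^-1 ^+ n by rewrite exprVn exprS mulfK ?expf_neq0.
by apply: subring_setM => //; apply: subring_setX => //; exact: maximal_ideal_sub.
Qed.

Lemma sum_congr1 n (E : 'I_n -> F) :
  (forall i, m (E i - 1)) -> m (\sum_i E i - n%:R).
Proof.
move=> hE; rewrite -[n in n%:R]card_ord -sumr_const -sumrB.
by apply: big_ind => //; [exact: maximal_ideal0|exact: maximal_idealD].
Qed.

(** If x differs from 1, the sum of the x^i for i < n vanishes, yet it is congruent to n. *)
Lemma root_of_unity_congr1 n x : ~ m n%:R -> x ^+ n = 1 -> m (x - 1) -> x = 1.
Proof.
move=> hn xn mx; apply: contrapT => /eqP; rewrite -subr_eq0 => x1.
have : (x - 1) * (\sum_(i < n) x ^+ i) = 0 by rewrite -subrX1 xn subrr.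
move=> /eqP; rewrite mulf_eq0 (negPf x1) /= => /eqP s0; apply: hn.
have := @sum_congr1 n (fun i => x ^+ i) (fun i => congr1X i mx).
by rewrite s0 sub0r => /maximal_idealN; rewrite opprK.
Qed.

End ValuationRing.

(** * Roots in congruence subgroups of SU(2) *)

(* The matrix [[a, b], [- b^*, a^*]] of determinant 1, given by its first row. *)
Record su2 (C : numClosedFieldType) := SU2 {
  su2_row :> C * C;
  su2_norm : su2_row.1 * su2_row.1^* + su2_row.2 * su2_row.2^* == 1 }.

HB.instance Definition _ (C : numClosedFieldType) := [isSub for @su2_row C].
HB.instance Definition _ (C : numClosedFieldType) := [Choice of su2 C by <:].

Section SU2Group.
Variable C : numClosedFieldType.
Implicit Types g h : su2 C.

Lemma su2_normE g : g.1 * g.1^* + g.2 * g.2^* = 1.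
Proof. exact/eqP/su2_norm. Qed.

Lemma su2_ext g h : g.1 = h.1 -> g.2 = h.2 -> g = h.
Proof.
move=> e1 e2; apply: val_inj.
by rewrite /= [LHS]surjective_pairing e1 e2 -surjective_pairing.
Qed.

Lemma su2_one_norm : let p : C * C := (1, 0) in p.1 * p.1^* + p.2 * p.2^* == 1.
Proof. by rewrite /= rmorph1 mul0r addr0 mulr1. Qed.
Definition su2_one := SU2 su2_one_norm.

Lemma su2_mul_norm g h :
  let p := (g.1 * h.1 - g.2 * h.2^*, g.1 * h.2 + g.2 * h.1^*) in
  p.1 * p.1^* + p.2 * p.2^* == 1.
Proof.
apply/eqP => /=; rewrite !(rmorphD, rmorphN, rmorphM) /= !conjCK.
transitivity ((g.1 * g.1^* + g.2 * g.2^*) * (h.1 * h.1^* + h.2 * h.2^*)); first by ring.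
by rewrite !su2_normE mulr1.
Qed.
Definition su2_mul g h := SU2 (su2_mul_norm g h).

Lemma su2_inv_norm g :
  let p := (g.1^*, - g.2) in p.1 * p.1^* + p.2 * p.2^* == 1.
Proof. by rewrite /= rmorphN mulrNN /= conjCK mulrC su2_normE. Qed.
Definition su2_inv g := SU2 (su2_inv_norm g).

Lemma su2_mulA : associative su2_mul.
Proof.
move=> g h k; apply: su2_ext => /=;
  rewrite !(rmorphD, rmorphN, rmorphM) /= !conjCK; ring.
Qed.

Lemma su2_mul1 : left_id su2_one su2_mul.
Proof. by move=> g; apply: su2_ext => /=; ring. Qed.

Lemma su2_mulr1 : right_id su2_one su2_mul.
Proof. by move=> g; apply: su2_ext => /=; rewrite ?rmorph0 ?rmorph1; ring. Qed.

Lemma su2_mulV : left_inverse su2_one su2_inv su2_mul.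
Proof.
move=> g; apply: su2_ext => /=; last by ring.
by rewrite mulNr opprK [X in X + _]mulrC su2_normE.
Qed.

Lemma su2_mulrV : right_inverse su2_one su2_inv su2_mul.
Proof.
move=> g; apply: su2_ext => /=; rewrite ?conjCK; last by ring.
by rewrite rmorphN mulrN opprK su2_normE.
Qed.

HB.instance Definition _ :=
  isGroup.Build (su2 C) su2_mulA su2_mul1 su2_mulr1 su2_mulV su2_mulrV.

Lemma su2M1 g h : (g * h)%g.1 = g.1 * h.1 - g.2 * h.2^*. Proof. by []. Qed.
Lemma su2M2 g h : (g * h)%g.2 = g.1 * h.2 + g.2 * h.1^*. Proof. by []. Qed.
Lemma su2V1 g : (g^-1)%g.1 = g.1^*. Proof. by []. Qed.
Lemma su2V2 g : (g^-1)%g.2 = - g.2. Proof. by []. Qed.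
Lemma su2_11 : (1%g : su2 C).1 = 1. Proof. by []. Qed.

Definition su2_tr g : C := g.1 + g.1^*.

(* Chebyshev polynomials of the second kind: if g has trace t, Cayley-Hamilton
   gives [g ^ n = u g + v] for [(u, v) = cheb t n]. *)
Fixpoint cheb (t : C) (n : nat) : C * C :=
  if n is k.+1 then ((cheb t k).2 + t * (cheb t k).1, - (cheb t k).1) else (0, 1).

Lemma su2_pow g n :
  (g ^+ n)%g.1 = (cheb (su2_tr g) n).1 * g.1 + (cheb (su2_tr g) n).2 /\
  (g ^+ n)%g.2 = (cheb (su2_tr g) n).1 * g.2.
Proof.
elim: n => [|n [IH1 IH2]]; first by rewrite /= !mul0r add0r.
rewrite expgSr su2M1 su2M2 IH1 IH2 /= /su2_tr; split; last by ring.
have e := su2_normE g.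
(* Multiplying by the determinant, which is 1, turns the claim into a ring identity. *)
have -> : - (cheb (g.1 + g.1^*) n).1 = - (cheb (g.1 + g.1^*) n).1 *
   (g.1 * g.1^* + g.2 * g.2^*) by rewrite e mulr1.
by ring.
Qed.

Lemma cheb_conj t n : t^* = t ->
  (cheb t n).1^* = (cheb t n).1 /\ (cheb t n).2^* = (cheb t n).2.
Proof.
move=> tt; elim: n => [|n [e1 e2]] /=; first by rewrite rmorph0 rmorph1.
by rewrite rmorphD rmorphM rmorphN /= e1 e2 tt.
Qed.

Lemma su2_tr_conj g : (su2_tr g)^* = su2_tr g.
Proof. by rewrite /su2_tr rmorphD /= conjCK addrC. Qed.

End SU2Group.

(** * Unique roots of matrices congruent to 1 *)

Section Congruence.
Variables (C : numClosedFieldType) (O : set C).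
Hypothesis vO : valuation_ring O.
Let hO : subring_set O := proj1 vO.
Let m := maximal_ideal O.
Implicit Types g h : su2 C.

(** Complex conjugation need not preserve the maximal ideal, so all four matrix entries are
    constrained. *)
Definition su2_congr : set (su2 C) :=
  [set g | [/\ m (g.1 - 1), m (g.1^* - 1), m g.2 & m g.2^*]].

Lemma su2_congr1 : su2_congr 1%g.
Proof.
have := maximal_ideal0 vO.
by split; rewrite /= ?rmorph1 ?rmorph0 ?subrr.
Qed.

Lemma su2_congrM g h : su2_congr g -> su2_congr h -> su2_congr (g * h)%g.
Proof.
move=> [g1 g1c g2 g2c] [h1 h1c h2 h2c].
have [Og Oh] := (congr1_mem vO g1, congr1_mem vO h1).
have [Ogc Ohc] := (congr1_mem vO g1c, congr1_mem vO h1c).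
have mM := maximal_idealM vO.
have [Og2 Og2c] := (maximal_ideal_sub g2, maximal_ideal_sub g2c).
split; rewrite ?su2M1 ?su2M2 ?(rmorphD, rmorphN, rmorphM) /= ?conjCK.
- rewrite addrAC; apply: (maximal_idealB vO); [exact: (congr1M vO)|exact: mM].
- rewrite addrAC; apply: (maximal_idealB vO); [exact: (congr1M vO)|exact: mM].
- by apply: (maximal_idealD vO); [|rewrite mulrC]; exact: mM.
- by apply: (maximal_idealD vO); [|rewrite mulrC]; exact: mM.
Qed.

Lemma su2_congrV g : su2_congr g -> su2_congr g^-1%g.
Proof.
move=> [g1 g1c g2 g2c]; split; rewrite ?su2V1 ?su2V2 ?rmorphN ?conjCK //=;
  exact: (maximal_idealN vO).
Qed.

Lemma su2_congrX n g : su2_congr g -> su2_congr (g ^+ n)%g.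
Proof.
move=> hg; elim: n => [|n IH]; first exact: su2_congr1.
by rewrite expgS; exact: su2_congrM.
Qed.

(** At trace 2, Cayley-Hamilton gives g^n = n g + (1 - n); the induction follows both coefficients
    together. *)
Lemma cheb_congr t n : m (t - 2) -> m ((cheb t n).1 - n%:R).
Proof.
move=> mt; suff [] : m ((cheb t n).1 - n%:R) /\ m ((cheb t n).2 + n%:R - 1) by [].
elim: n => [|n [IH1 IH2]] /=.
  by rewrite subr0 addr0 subrr; split; exact: (maximal_ideal0 vO).
have Ot : O t.
  rewrite -(subrK 2 t); apply: (subring_setD hO); first exact: maximal_ideal_sub.
  exact: (subring_set_nat hO).
split.
  have -> : (cheb t n).2 + t * (cheb t n).1 - n.+1%:R =
    ((cheb t n).2 + n%:R - 1) + (t * ((cheb t n).1 - n%:R) + n%:R * (t - 2)).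
    by rewrite -natr1; ring.
  apply: (maximal_idealD vO) => //; apply: (maximal_idealD vO);
    apply: (maximal_idealM vO) => //; exact: (subring_set_nat hO).
have -> : - (cheb t n).1 + n.+1%:R - 1 = - ((cheb t n).1 - n%:R).
  by rewrite -natr1; ring.
exact: (maximal_idealN vO).
Qed.

Lemma su2_congr_tr g : su2_congr g -> m (su2_tr g - 2).
Proof.
move=> [g1 g1c _ _]; have -> : su2_tr g - 2 = (g.1 - 1) + (g.1^* - 1).
  by rewrite /su2_tr; ring.
exact: (maximal_idealD vO).
Qed.

Lemma su2_congr_cheb_neq0 g n :
  su2_congr g -> ~ m n%:R -> (cheb (su2_tr g) n).1 != 0.
Proof.
move=> /su2_congr_tr /(cheb_congr n) h hn; apply: contra_notN hn => /eqP u0.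
by move: h; rewrite u0 sub0r => /(maximal_idealN vO); rewrite opprK.
Qed.

(** Since g^n = u g + v with scalars u and v and u nonzero, whatever commutes with g^n commutes with
    g. *)
Lemma su2_congr_commute g h n : su2_congr g -> ~ m n%:R ->
  commute (g ^+ n)%g h -> commute g h.
Proof.
move=> hg hn; have u0 := su2_congr_cheb_neq0 hg hn.
have [uc vc] := cheb_conj n (su2_tr_conj g); have [p1 p2] := su2_pow g n.
move: (cheb _ _).1 (cheb _ _).2 u0 uc vc p1 p2 => u v u0 uc vc p1 p2 e.
have e1 : (g ^+ n * h)%g.1 = (h * g ^+ n)%g.1 by rewrite e.
have e2 : (g ^+ n * h)%g.2 = (h * g ^+ n)%g.2 by rewrite e.
move: e1 e2; rewrite !su2M1 !su2M2 p1 p2 !(rmorphD, rmorphM) /= uc vc => e1 e2.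
apply: su2_ext; rewrite ?su2M1 ?su2M2; apply: (mulfI u0); apply/eqP.
  rewrite -subr_eq0; move/eqP: e1; rewrite -subr_eq0; apply/etrans.
  by congr (_ == 0); ring.
rewrite -subr_eq0; move/eqP: e2; rewrite -subr_eq0; apply/etrans.
by congr (_ == 0); ring.
Qed.

Lemma su2_diagX g n : g.2 = 0 -> (g ^+ n)%g.1 = g.1 ^+ n /\ (g ^+ n)%g.2 = 0.
Proof.
move=> g2; elim: n => [|n [e1 e2]] //.
by rewrite expgS exprS su2M1 su2M2 e1 e2 g2 !mul0r mulr0 subr0 addr0.
Qed.

(** As u is nonzero in g^n = u g + v, the matrix g is diagonal; its entry is then an n-th root of
    unity congruent to 1. *)
Lemma su2_congr_torsion_free g n :
  su2_congr g -> ~ m n%:R -> (g ^+ n)%g = 1%g -> g = 1%g.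
Proof.
move=> hg hn gn; have u0 := su2_congr_cheb_neq0 hg hn.
have [_] := su2_pow g n; rewrite gn => /esym/eqP.
rewrite mulf_eq0 (negPf u0) /= => /eqP g2.
have [e1 _] := su2_diagX n g2; apply: su2_ext => //.
case: hg => m1 _ _ _; apply: (root_of_unity_congr1 vO hn _ m1).
by rewrite -e1 gn.
Qed.

(** h commutes with h^n = g^n, hence with g, and then g / h is torsion. *)
Lemma su2_congr_root_uniq g h n : su2_congr g -> su2_congr h -> ~ m n%:R ->
  (g ^+ n = h ^+ n)%g -> g = h.
Proof.
move=> hg hh hn e.
have cgh : commute g h.
  by apply: (su2_congr_commute hg hn); rewrite e; exact/commute_sym/commuteX.
have : (g / h)%g = 1%g.
  apply: (su2_congr_torsion_free (n := n)) => //.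
    by apply: su2_congrM => //; exact: su2_congrV.
  by rewrite expgnFl// e mulgV.
by move/divg1_eq.
Qed.

Lemma unit_root_conj n (w z : C) :
  (0 < n)%N -> w ^+ n = z -> z * z^* = 1 -> w * w^* = 1.
Proof.
move=> n0 wz zz; apply/eqP; rewrite -(pexpr_eq1 n0) ?mul_conjC_ge0//.
by rewrite exprMn -rmorphXn wz zz.
Qed.

(** The product of 1 - x over the n-th roots x of z, counted with multiplicity, is 1 - z. It lies in
    the prime ideal m, so some factor does. *)
Lemma root_congr1 n (z : C) : (0 < n)%N -> m (z - 1) ->
  exists2 w, w ^+ n = z & m (w - 1).
Proof.
move=> n0 mz.
have [p pm pE] : exists2 p : {poly C}, p \is monic & forall x, p.[x] = x ^+ n - z.
  by exists ('X^n - z%:P) => [|x]; rewrite ?hornerE// monicXnsubC.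
have [r rE] := closed_field_poly_normal p.
rewrite (monicP pm) scale1r in rE.
have rP x : x \in r -> x ^+ n = z.
  move=> xr; have : root p x by rewrite rE root_prod_XsubC.
  by rewrite /root pE subr_eq0 => /eqP.
have p1 : \prod_(x <- r) (1 - x) = 1 - z.
  have := pE 1; rewrite expr1n rE horner_prod => <-.
  by apply: eq_bigr => x _; rewrite !hornerE.
have Or : {in r, forall x, O (1 - x)}.
  move=> x xr; apply: (subring_setB hO); first exact: (subring_set1 hO).
  by apply: (valuation_root vO n0); rewrite (rP x xr); exact: (congr1_mem vO).
have : m (\prod_(x <- r) (1 - x)) by rewrite p1 -opprB; exact: (maximal_idealN vO).
move=> /(maximal_ideal_prod vO Or)[x xr mx]; exists x; first exact: rP.
by rewrite -opprB; exact: (maximal_idealN vO).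
Qed.

Lemma unit_with_trace (t : C) : t^* = t -> 0 <= 4 - t ^+ 2 -> 4 - t ^+ 2 != 0 ->
  exists z, [/\ z + z^* = t, z * z^* = 1 & z - z^* != 0].
Proof.
move=> tc d0 dn0; set d := 4 - _ in d0 dn0.
pose r := sqrtC d; have rc : r^* = r by rewrite conj_Creal// ger0_real ?sqrtC_ge0.
have r0 : r != 0 by rewrite sqrtC_eq0.
have r2 : r ^+ 2 = d by exact: sqrtCK.
have i2 : 'i ^+ 2 = -1 :> C by exact: sqrCi.
pose z := (t + 'i * r) / 2.
have zc : z^* = (t - 'i * r) / 2.
  by rewrite /z !(rmorphD, rmorphM) /= fmorphV rmorph_nat conjCi tc rc mulNr.
exists z; rewrite zc /z; split; first by field.
  have -> : (t + 'i * r) / 2 * ((t - 'i * r) / 2) =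
    (t ^+ 2 - 'i ^+ 2 * r ^+ 2) / 4 by field.
  by rewrite i2 r2 /d; field.
have -> : (t + 'i * r) / 2 - (t - 'i * r) / 2 = 'i * r by field.
by rewrite mulf_neq0 ?neq0Ci.
Qed.

(** For g with first row a, b and trace t, 4 - t^2 = |a - a^*|^2 + 4 |b|^2 vanishes only at 1 and
    -1, and -1 is excluded because 2 is not in m. The eigenvalue is congruent to 1 because (z - 1)^2
    = z (t - 2). *)
Lemma su2_congr_eigenvalue g : su2_congr g -> ~ m 2 -> g <> 1%g ->
  exists z, [/\ z + z^* = su2_tr g, z * z^* = 1, z - z^* != 0 & m (z - 1)].
Proof.
move=> hg m2 g1; have [m1 m1c _ _] := hg.
pose x := g.1 - g.1^*; pose d := 4 - su2_tr g ^+ 2.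
have xc : x^* = - x by rewrite /x rmorphB /= conjCK opprB.
have dE : d = x * x^* + 4 * (g.2 * g.2^*).
  have e : g.2 * g.2^* = 1 - g.1 * g.1^* by rewrite -(su2_normE g) addrC addKr.
  by rewrite xc e /x /d /su2_tr; ring.
have d0 : 0 <= d by rewrite dE addr_ge0 ?mul_conjC_ge0// (mulr_ge0 (ler0n _ _))// mul_conjC_ge0.
have dn0 : d != 0.
  apply: contra_notN g1; rewrite dE paddr_eq0 ?mul_conjC_ge0// ?(mulr_ge0 (ler0n _ _)) ?mul_conjC_ge0//.
  rewrite mul_conjC_eq0 mulf_eq0 pnatr_eq0 /= mul_conjC_eq0 subr_eq0 => /andP[/eqP g1r /eqP g2].
  apply: su2_ext => //; apply/eqP; rewrite -subr_eq0; apply: contra_notT m2 => g11.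
  have : (g.1 - 1) * (g.1 + 1) == 0.
    rewrite -subr_sqr expr1n subr_eq0 -[X in _ == X](su2_normE g) g2 mul0r addr0.
    by rewrite -g1r.
  rewrite mulf_eq0 (negPf g11) /= => /eqP g1m.
  have -> : 2 = - (g.1 - 1) + (g.1 + 1) by ring.
  by rewrite g1m addr0; exact: (maximal_idealN vO).
have [z [zt zz zn]] := unit_with_trace (su2_tr_conj g) d0 dn0.
exists z; split=> //; move: (su2_tr g) zt (su2_congr_tr hg) => t zt mt {d d0 dn0 dE}.
have Ot : O t.
  rewrite -(subrK 2 t); apply: (subring_setD hO); first exact: maximal_ideal_sub.
  exact: (subring_set_nat hO).
have Oz : O z.
  (* If z is not in O, then z^-1 is in m, but z = t - z^-1. *)
  apply: contrapT => nz; apply: (nz); have := valuation_invN vO nz => /maximal_ideal_sub.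
  have -> : z^-1 = z^*.
    have z0 : z != 0 by apply/eqP => z0; move: zz; rewrite z0 mul0r => /esym/eqP; rewrite oner_eq0.
    by apply: (mulfI z0); rewrite mulfV// zz.
  by move=> h; rewrite -(addrK z^* z) zt; exact: (subring_setB hO).
apply: (maximal_idealX vO (n := 2)); first exact: (subring_setB hO Oz (subring_set1 hO)).
have -> : (z - 1) ^+ 2 = z * (t - 2).
  rewrite -zt; have -> : z * (z + z^* - 2) = z ^+ 2 - 2 * z + z * z^* by ring.
  by rewrite zz; ring.
exact: (maximal_idealM vO).
Qed.

(** X k and Y k solve X k z + Y k = w^k and X k z^-1 + Y k = w^-k. The recursion multiplies X k g +
    Y k by X 1 g + Y 1, using g^2 = (z + z^-1) g - 1. *)
Lemma su2_root_coef (z w : C) (k : nat) : z != 0 -> w != 0 -> z - z^-1 != 0 ->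
  let X k := (w ^+ k - w^-1 ^+ k) / (z - z^-1) in
  let Y k := (z * w^-1 ^+ k - z^-1 * w ^+ k) / (z - z^-1) in
  X k.+1 = X k * X 1 * (z + z^-1) + X k * Y 1 + Y k * X 1 /\
  Y k.+1 = Y k * Y 1 - X k * X 1.
Proof.
move=> z0 w0 d0 X Y; rewrite /X /Y !exprS !expr0 !mulr1 !exprVn.
have v0 : w ^+ k != 0 by rewrite expf_neq0.
have dd : z * z - 1 != 0.
  by apply: contraNneq d0 => e; rewrite -(mulKf z0 (z - z^-1)) mulrBr mulfV// e mulr0.
move: (w ^+ k) v0 => v v0; split; field; rewrite ?z0 ?w0 ?v0 ?dd//.
Qed.

Lemma su2_congr_root_exists g n : su2_congr g -> (0 < n)%N -> ~ m n%:R -> ~ m 2 ->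
  exists2 h, su2_congr h & (h ^+ n)%g = g.
Proof.
move=> hg n0 mn m2; have [->|/eqP g1] := eqVneq g 1%g.
  by exists 1%g; [exact: su2_congr1|exact: expg1n].
have [z [zt zz dz mz]] := su2_congr_eigenvalue hg m2 g1.
have [w wz mw] := root_congr1 n0 mz.
have ww := unit_root_conj n0 wz zz.
have inv_conj (x : C) : x * x^* = 1 -> x != 0 /\ x^* = x^-1.
  move=> xx; have x0 : x != 0.
    by apply/eqP => x0; move: xx; rewrite x0 mul0r => /esym/eqP; rewrite oner_eq0.
  by split=> //; apply: (mulfI x0); rewrite mulfV.
have [z0 zV] := inv_conj _ zz; have [w0 wV] := inv_conj _ ww.
(* The root is x g + y, with x and y chosen to send the eigenvalues z, z^* to w, w^*. Both are real,
   so x g + y keeps the shape of an element of SU(2). *)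
have [x xE] : exists x, x = (w - w^*) / (z - z^*) by eexists.
have [y yE] : exists y, y = w - x * z by eexists.
have xc : x^* = x.
  by rewrite xE rmorphM fmorphV !rmorphB /= !conjCK -opprB -[z^* - z]opprB invrN mulrNN.
have yE' : y = w^* - x * z^*.
  by apply/eqP; rewrite -subr_eq0; apply/eqP; rewrite yE xE; field.
have yc : y^* = y by rewrite [RHS]yE' yE rmorphB rmorphM /= xc.
have hn : let p := (x * g.1 + y, x * g.2) in p.1 * p.1^* + p.2 * p.2^* == 1.
  apply/eqP; rewrite /= rmorphD !rmorphM /= xc yc.
  have -> : (x * g.1 + y) * (x * g.1^* + y) + x * g.2 * (x * g.2^*) =
     x ^+ 2 * (g.1 * g.1^* + g.2 * g.2^*) + x * y * su2_tr g + y ^+ 2.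
    by rewrite /su2_tr; ring.
  rewrite su2_normE -[RHS]ww -zz -zt.
  have -> : w = x * z + y by rewrite yE addrC subrK.
  have -> : (x * z + y)^* = x * z^* + y by rewrite rmorphD rmorphM /= xc yc.
  by ring.
pose h := SU2 hn.
pose X k := (w ^+ k - w^-1 ^+ k) / (z - z^-1).
pose Y k := (z * w^-1 ^+ k - z^-1 * w ^+ k) / (z - z^-1).
have X1 : X 1%N = x by rewrite /X xE !expr1 zV wV.
have Y1 : Y 1%N = y.
  rewrite yE -X1 /X /Y !expr1; rewrite zV in dz.
  have dd : z * z - 1 != 0.
    by apply: contraNneq dz => e; rewrite -(mulKf z0 (z - z^-1)) mulrBr mulfV// e mulr0.
  by field; rewrite z0 dd w0.
have dz' : z - z^-1 != 0 by rewrite -zV.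
have hX k : (h ^+ k)%g.1 = X k * g.1 + Y k /\ (h ^+ k)%g.2 = X k * g.2.
  elim: k => [|k [IH1 IH2]].
    by rewrite /X /Y !expr0 subrr mul0r !mul0r add0r !mulr1 divff.
  have [XS YS] := @su2_root_coef z w k z0 w0 dz'.
  rewrite expgSr su2M1 su2M2 IH1 IH2 /= rmorphD !rmorphM /= xc yc.
  rewrite -/(X k.+1) -/(X k) -/(Y k) -/(X 1%N) -/(Y 1%N) X1 Y1 -zV zt in XS.
  rewrite -/(Y k.+1) -/(X k) -/(Y k) -/(X 1%N) -/(Y 1%N) X1 Y1 in YS.
  rewrite XS YS /su2_tr; split; last by ring.
  have -> : Y k * y - X k * x =
    Y k * y - X k * x * (g.1 * g.1^* + g.2 * g.2^*) by rewrite su2_normE mulr1.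
  by ring.
have Xn : X n = 1 by rewrite /X exprVn wz divff.
have Yn : Y n = 0 by rewrite /Y exprVn wz mulfV// mulVf// subrr mul0r.
exists h; last first.
  have [e1 e2] := hX n; apply: su2_ext; first by rewrite e1 Xn Yn mul1r addr0.
  by rewrite e2 Xn mul1r.
have Ox : O x.
  (* S is the quotient of w^n - w^-n by w - w^-1; it is congruent to n, so x = S^-1 lies in O. *)
  pose S := \sum_(i < n) w ^+ (n.-1 - i) * w^-1 ^+ i.
  have mS : m (S - n%:R).
    apply: (sum_congr1 vO) => i; apply: (congr1M vO); apply: (congr1X vO) => //.
    exact: (congr1V vO).
  have zS : z - z^-1 = (w - w^-1) * S by rewrite -wz -exprVn subrXX.
  have xS : x = S^-1.
    rewrite -X1 /X !expr1 zS; have := dz'; rewrite zS mulf_eq0 negb_or => /andP[a0 b0].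
    by rewrite invfM mulrA divff// mul1r.
  have OS : O S.
    rewrite -(subrK n%:R S); apply: (subring_setD hO); first exact: maximal_ideal_sub.
    exact: (subring_set_nat hO).
  rewrite xS; apply: (valuation_inv OS) => mS'; apply: mn; have -> : n%:R = S - (S - n%:R) :> C by rewrite subKr.
  exact: (maximal_idealB vO).
have mxy : m (x + y - 1).
  have -> : x + y - 1 = (w - 1) - x * (z - 1) by rewrite yE; ring.
  by apply: (maximal_idealB vO) => //; exact: (maximal_idealM vO).
have [g11 g1c g2 g2c] := hg.
split; rewrite /= ?(rmorphD, rmorphM) /= ?xc ?yc; try exact: (maximal_idealM vO).
  have -> : x * g.1 + y - 1 = x * (g.1 - 1) + (x + y - 1) by ring.
  by apply: (maximal_idealD vO) => //; exact: (maximal_idealM vO).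
have -> : x * g.1^* + y - 1 = x * (g.1^* - 1) + (x + y - 1) by ring.
by apply: (maximal_idealD vO) => //; exact: (maximal_idealM vO).
Qed.

End Congruence.

(** * Sequences in SU(2) *)

Section SU2Length.
Variable C : numClosedFieldType.
Implicit Types g h : su2 C.

(** The squared distance |g.1 - 1|^2 + |g.2|^2 from g to 1, in a form invariant under
    conjugation. *)
Definition su2_len g : C := 2 - su2_tr g.

Lemma su2_trMC g h : su2_tr (g * h)%g = su2_tr (h * g)%g.
Proof. by rewrite /su2_tr !su2M1 !(rmorphD, rmorphN, rmorphM) /= !conjCK; ring. Qed.

Lemma su2_lenMC g h : su2_len (g * h)%g = su2_len (h * g)%g.
Proof. by rewrite /su2_len su2_trMC. Qed.

Lemma su2_len1 : su2_len 1%g = 0.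
Proof. by rewrite /su2_len /su2_tr su2_11 rmorph1; ring. Qed.

Lemma su2_lenV g : su2_len g^-1%g = su2_len g.
Proof. by rewrite /su2_len /su2_tr su2V1 conjCK [X in 2 - X]addrC. Qed.

Lemma su2_lenJ g h : su2_len (h * g / h)%g = su2_len g.
Proof. by rewrite su2_lenMC mulgA mulVg mul1g. Qed.

Lemma su2_lenE g : su2_len g = (g.1 - 1) * (g.1 - 1)^* + g.2 * g.2^*.
Proof.
have e : g.2 * g.2^* = 1 - g.1 * g.1^* by rewrite -(su2_normE g) addrC addKr.
by rewrite e /su2_len /su2_tr rmorphB rmorph1; ring.
Qed.

Lemma su2_len_ge0 g : 0 <= su2_len g.
Proof. by rewrite su2_lenE addr_ge0 ?mul_conjC_ge0. Qed.

Lemma su2_len_eq0 g : su2_len g = 0 -> g = 1%g.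
Proof.
move/eqP; rewrite su2_lenE paddr_eq0 ?mul_conjC_ge0// !mul_conjC_eq0 subr_eq0.
by move=> /andP[/eqP e1 /eqP e2]; exact: su2_ext.
Qed.

(* The parallelogram identity for [h - 1] and [1 - g^-1], whose sum [h - g^-1] has
   the norm of [g h - 1]. *)
Lemma su2_lenM g h : su2_len (g * h)%g <= 2 * su2_len g + 2 * su2_len h.
Proof.
rewrite -subr_ge0.
have -> : 2 * su2_len g + 2 * su2_len h - su2_len (g * h)%g =
  (h.1 + g.1^* - 2) * (h.1 + g.1^* - 2)^* + (h.2 - g.2) * (h.2 - g.2)^*.
  have eg : g.2 * g.2^* = 1 - g.1 * g.1^* by rewrite -(su2_normE g) addrC addKr.
  have eh : h.2 * h.2^* = 1 - h.1 * h.1^* by rewrite -(su2_normE h) addrC addKr.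
  rewrite /su2_len /su2_tr su2M1 !(rmorphD, rmorphN, rmorphM) /= !conjCK ?rmorph1 ?rmorph_nat.
  have -> : (h.2 - g.2) * (h.2^* - g.2^*) =
     h.2 * h.2^* + g.2 * g.2^* - h.2 * g.2^* - h.2^* * g.2 by ring.
  by rewrite eg eh; ring.
by rewrite addr_ge0 ?mul_conjC_ge0.
Qed.

Definition su2_close (s t : nat -> su2 C) : Prop :=
  forall e : C, 0 < e -> exists N, forall k, (N <= k)%N -> su2_len (s k / t k)%g < e.

Lemma su2_close_le (s t s' t' s'' t'' : nat -> su2 C) :
  (forall k, su2_len (s k / t k)%g <=
     2 * su2_len (s' k / t' k)%g + 2 * su2_len (s'' k / t'' k)%g) ->
  su2_close s' t' -> su2_close s'' t'' -> su2_close s t.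
Proof.
(* Two terms below e / 4, each with a factor 2, add up to less than e. *)
move=> le c c' e e0; have e40 : 0 < e / 4 by rewrite divr_gt0// ltr0n.
have [[N hN] [N' hN']] := (c _ e40, c' _ e40).
exists (maxn N N') => k; rewrite geq_max => /andP[/hN h /hN' h'].
apply: le_lt_trans (le k) _.
have -> : e = 2 * (e / 4) + 2 * (e / 4) by field.
by rewrite ltrD// ltr_pM2l// ltr0n.
Qed.

Lemma eventually_su2_close (s t : nat -> su2 C) N :
  (forall k, (N <= k)%N -> s k = t k) -> su2_close s t.
Proof. by move=> h e e0; exists N => k /h ->; rewrite mulgV su2_len1. Qed.

Definition limit_setoid : group_setoid.
Proof.
refine (@GroupSetoid (nat -> su2 C) su2_close (fun=> 1%g)
  (fun s t k => (s k * t k)%g) (fun s k => (s k)^-1%g) _ _ _ _ _ _ _ _ _ _).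
- by move=> s; apply: (@eventually_su2_close _ _ 0).
- move=> s t c e e0; have [N hN] := c _ e0; exists N => k /hN.
  by rewrite -[X in X < _]su2_lenV invgF.
- move=> s t u; apply: su2_close_le => k; apply: le_trans (su2_lenM _ _).
  by rewrite mulgA mulgVK.
- move=> s s' t t' c c'; apply: su2_close_le c' c => k.
  (* By conjugation invariance, t / t' may be conjugated by s. *)
  rewrite -[su2_len (t k / t' k)%g](su2_lenJ _ (s k)).
  by apply: le_trans (su2_lenM _ _); rewrite invgM !mulgA mulgVK.
- move=> s s' c e e0; have [N hN] := c _ e0; exists N => k /hN.
  by rewrite -[X in X < _]su2_lenV invgF invgK su2_lenMC.
- by move=> s t u; apply: (@eventually_su2_close _ _ 0) => k _; rewrite mulgA.
- by move=> s; apply: (@eventually_su2_close _ _ 0) => k _; rewrite mul1g.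
- by move=> s; apply: (@eventually_su2_close _ _ 0) => k _; rewrite mulg1.
- by move=> s; apply: (@eventually_su2_close _ _ 0) => k _; rewrite mulVg.
- by move=> s; apply: (@eventually_su2_close _ _ 0) => k _; rewrite mulgV.
Defined.

Definition limit_group : groupType := gquot limit_setoid.

Definition limit_const (g : su2 C) : limit_group :=
  @gclass limit_setoid (fun=> g).

Lemma limit_constM : {morph limit_const : g h / (g * h)%g}.
Proof. by move=> g h; rewrite /limit_const -gclassM. Qed.

HB.instance Definition _ :=
  isMultiplicative.Build (su2 C) limit_group limit_const limit_constM.

Lemma limit_const_eq1 g : limit_const g = 1%g -> g = 1%g.
Proof.
move=> /gclassP /= close; apply: su2_len_eq0; apply/eqP/contraT => n0.
have g0 : 0 < su2_len g by rewrite lt0r n0 su2_len_ge0.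
by have [N /(_ N (leqnn N))] := close _ g0; rewrite invg1 mulg1 ltxx.
Qed.

End SU2Length.

(** * Sequences in congruence subgroups modulo eventual equality *)

Section CongruenceProduct.
Variables (C : numClosedFieldType) (O : nat -> set C).
Hypothesis vO : forall k, valuation_ring (O k).

Record congr_seq := CongrSeq {
  congr_seq_val :> nat -> su2 C;
  congr_seqP : forall k, su2_congr (O k) (congr_seq_val k) }.

Definition congr_seq1 : congr_seq := CongrSeq (fun k => su2_congr1 (vO k)).
Definition congr_seqM (s t : congr_seq) : congr_seq :=
  CongrSeq (fun k => su2_congrM (vO k) (congr_seqP s k) (congr_seqP t k)).
Definition congr_seqV (s : congr_seq) : congr_seq :=
  CongrSeq (fun k => su2_congrV (vO k) (congr_seqP s k)).
Definition congr_seqX (s : congr_seq) n : congr_seq :=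
  CongrSeq (fun k => su2_congrX (vO k) n (congr_seqP s k)).

Definition eventually_eq (s t : congr_seq) : Prop :=
  exists N, forall k, (N <= k)%N -> s k = t k.

Lemma eventually_eq_map2 (s t s' t' s'' t'' : congr_seq) :
  (forall k, s k = t k -> s' k = t' k -> s'' k = t'' k) ->
  eventually_eq s t -> eventually_eq s' t' -> eventually_eq s'' t''.
Proof.
move=> h [N hN] [N' hN']; exists (maxn N N') => k.
by rewrite geq_max => /andP[/hN e /hN' e']; exact: h.
Qed.

Lemma eq_eventually_eq (s t : congr_seq) : s =1 t -> eventually_eq s t.
Proof. by exists 0%N => k _. Qed.

Definition congr_setoid : group_setoid.
Proof.
refine (@GroupSetoid congr_seq eventually_eq congr_seq1 congr_seqM congr_seqV
  _ _ _ _ _ _ _ _ _ _).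
- by move=> s; exact: eq_eventually_eq.
- by move=> s t [N hN]; exists N => k /hN.
- by move=> s t u; apply: eventually_eq_map2 => k ->.
- by move=> s s' t t'; apply: eventually_eq_map2 => k /= -> ->.
- by move=> s s' [N hN]; exists N => k /hN /= ->.
- by move=> s t u; apply: eq_eventually_eq => k /=; rewrite mulgA.
- by move=> s; apply: eq_eventually_eq => k /=; rewrite mul1g.
- by move=> s; apply: eq_eventually_eq => k /=; rewrite mulg1.
- by move=> s; apply: eq_eventually_eq => k /=; rewrite mulVg.
- by move=> s; apply: eq_eventually_eq => k /=; rewrite mulgV.
Defined.

Definition congr_group : groupType := gquot congr_setoid.
Definition congr_class (s : congr_seq) : congr_group := @gclass congr_setoid s.

Lemma congr_classX s n : (congr_class s ^+ n)%g = congr_class (congr_seqX s n).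
Proof.
elim: n => [|n IH].
  by rewrite expg0 -gclass1; apply/gclassP; exact: eq_eventually_eq.
rewrite expgS IH /congr_class -gclassM; apply/gclassP; apply: eq_eventually_eq => k /=.
by rewrite expgS.
Qed.

Hypothesis unitO :
  forall k n, (0 < n <= k)%N -> ~ maximal_ideal (O k) n%:R.

(** A given exponent is a unit modulo the maximal ideal of O k for all large k, and eventual
    equality ignores the other indices. *)
Lemma congr_group_uniquely_divisible : uniquely_divisible congr_group.
Proof.
apply/uniquely_divisibleP => n; split=> [x y|g].
  have [s ->] := gclass_surj x; have [t ->] := gclass_surj y.
  rewrite -!/(congr_class _) !congr_classX => /gclassP[N hN].
  apply/gclassP; exists (maxn N n.+1) => k; rewrite geq_max => /andP[/hN e nk].
  by apply: (su2_congr_root_uniq (vO k) (congr_seqP s k) (congr_seqP t k) _ e); exact: unitO.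
have [s ->] := gclass_surj g.
have rootP k : exists h, su2_congr (O k) h /\
    ((n.+2 <= k)%N -> (h ^+ n.+1)%g = s k).
  (* Small indices get the default root 1; from [n.+2] on, both the exponent [n.+1] and 2 are units,
     as [su2_congr_root_exists] asks. *)
  case: (leqP n.+2 k) => nk; last by exists 1%g; split=> //; exact: su2_congr1.
  have [|||h hh hE] := @su2_congr_root_exists C (O k) (vO k) (s k) n.+1 (congr_seqP s k).
  - by [].
  - by apply: unitO; rewrite /= ltnW.
  - by apply: (unitO (n := 2)); apply: leq_trans nk.
  by exists h.
have [r rP] := choice rootP.
pose t := CongrSeq (fun k => (rP k).1).
exists (congr_class t); rewrite congr_classX; apply/gclassP.
by exists n.+2 => k /(rP k).2.
Qed.

Lemma congr_to_limit : exists phi : {multiplicative congr_group -> limit_group C},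
  forall s, phi (congr_class s) = @gclass (limit_setoid C) s.
Proof.
apply: (@gquot_lift congr_setoid _ (fun s : congr_seq => @gclass (limit_setoid C) s)).
  by move=> s t [N hN]; apply/gclassP; exact: eventually_su2_close hN.
by move=> s t; rewrite -gclassM.
Qed.

End CongruenceProduct.

(** * Free rotations *)

(** Chevalley's theorem applied to the image of the integers, which does not contain p^-1. *)
Lemma exists_valuation_ring_nat (F : numFieldType) (p : nat) : (1 < p)%N ->
  exists O : set F, valuation_ring O /\ maximal_ideal O p%:R.
Proof.
move=> p1; pose Z : set F := [set x | exists k : int, x = k%:~R].
have [||||O [vO _ mp]] := @exists_valuation_ring F Z p%:R.
- split; first by exists 1.
    by move=> _ _ [k ->] [l ->]; exists (k - l); rewrite rmorphB.
  by move=> _ _ [k ->] [l ->]; exists (k * l); rewrite rmorphM.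
- by exists p.
- by rewrite pnatr_eq0 -lt0n ltnW.
- move=> [k kE].
  have p0 : p%:R != 0 :> F by rewrite pnatr_eq0 -lt0n ltnW.
  have : p%:R * k%:~R = 1 :> F by rewrite -kE mulfV.
  rewrite pmulrn -intrM => /eqP; rewrite -[1]/(1%:~R) eqr_int => /eqP pk.
  have : (Posz p %| 1)%Z by apply/dvdzP; exists k; rewrite mulrC pk.
  by rewrite dvdz1 /= => /eqP p1'; rewrite p1' in p1.
by exists O.
Qed.

Section NatUnits.
Variables (F : numFieldType) (O : set F) (p : nat).
Hypotheses (vO : valuation_ring O) (mp : maximal_ideal O p%:R).

Lemma coprime_notin_maximal_ideal q : coprime p q -> ~ maximal_ideal O q%:R.
Proof.
move=> cpq mq; apply: (@maximal_ideal1 _ O).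
have [q0|q0] := posnP q.
  move: cpq; rewrite q0 /coprime gcdn0 => /eqP p1.
  by move: mp; rewrite p1.
have [u v e _] := egcdnP p q0; rewrite gcdnC (eqP cpq) in e.
have -> : 1 = u%:R * q%:R - v%:R * p%:R :> F.
  by rewrite -!natrM e natrD addrAC subrr add0r.
apply: (maximal_idealB vO); apply: (maximal_idealM vO) => //;
  exact: (subring_set_nat (proj1 vO)).
Qed.

End NatUnits.

Section FreeRotations.
Variables (C : numClosedFieldType) (zeta : nat -> C) (a : nat -> su2 C) (b : su2 C).
Hypotheses (zeta0 : zeta 0%N ^+ 2 + zeta 0%N + 1 = 0)
  (zetaS : forall n, zeta n.+1 ^+ 3 = zeta n).
Hypotheses (a1 : forall n, (a n).1 = zeta n) (a2 : forall n, (a n).2 = 0).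
Hypotheses (b1 : b.1 = 'i * 3 / 5) (b2 : b.2 = 4 / 5).

Lemma zeta0_cube : zeta 0%N ^+ 3 = 1.
Proof.
apply/eqP; rewrite -subr_eq0.
have -> : zeta 0%N ^+ 3 - 1 = (zeta 0%N - 1) * (zeta 0%N ^+ 2 + zeta 0%N + 1) by ring.
by rewrite zeta0 mulr0.
Qed.

Lemma zeta0_neq1 : zeta 0%N != 1.
Proof.
apply/eqP => e; move: zeta0; rewrite e expr1n => /eqP.
have -> : 1 + 1 + 1 = 3 :> C by ring.
by rewrite pnatr_eq0.
Qed.

Lemma zetaX n k : zeta (n + k) ^+ (3 ^ k) = zeta n.
Proof.
elim: k => [|k IH]; first by rewrite addn0 expr1.
by rewrite addnS expnS exprM zetaS.
Qed.

Lemma zetaX_le n k : (n <= k)%N -> zeta k ^+ (3 ^ (k - n)) = zeta n.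
Proof. by move=> nk; rewrite -{1}(subnKC nk) zetaX. Qed.

Lemma zetaX_gt n k : (n < k)%N -> zeta n ^+ (3 ^ k) = 1.
Proof.
move=> nk; rewrite -(subnKC nk) addSn -addnS expnD exprM.
have := zetaX 0 n; rewrite add0n => ->.
by rewrite expnS exprM zeta0_cube expr1n.
Qed.

Lemma zeta_norm n : zeta n * (zeta n)^* = 1.
Proof.
apply: (@unit_root_conj _ (3 ^ n.+1) _ 1); rewrite ?expn_gt0 ?rmorph1 ?mulr1//.
exact: zetaX_gt.
Qed.

Definition rot (l : nat * bool) : su2 C := if l.2 then a l.1 else (a l.1)^-1%g.

Lemma rot2 l : (rot l).2 = 0.
Proof. by rewrite /rot; case: l => n [] /=; rewrite ?a2 ?oppr0. Qed.

Lemma rot1_norm l : (rot l).1 * (rot l).1^* = 1.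
Proof.
rewrite /rot; case: l => n [] /=; rewrite a1 ?conjCK; first exact: zeta_norm.
by rewrite mulrC zeta_norm.
Qed.

Lemma rot1X_gt l k : (l.1 < k)%N -> (rot l).1 ^+ (3 ^ k) = 1.
Proof.
rewrite /rot; case: l => n [] /= /zetaX_gt; rewrite a1 // => h.
by rewrite -rmorphXn h rmorph1.
Qed.

Lemma rot1X_eq l : (rot l).1 ^+ (3 ^ l.1) = (rot (0%N, l.2)).1.
Proof.
rewrite /rot; case: l => n [] /=; rewrite !a1 -?rmorphXn;
  by have := zetaX 0 n; rewrite add0n => ->.
Qed.

Lemma rot0_pow l k : (0 < k < 3)%N -> (rot (0%N, l)).1 ^+ k <> 1.
Proof.
move=> k3; set x := (rot _).1.
have x3 : x ^+ 3 = 1 by exact: (@rot1X_gt (0%N, l) 1).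
have x1 : x != 1.
  rewrite /x /rot; case: l {x x3} => /=; rewrite a1 ?zeta0_neq1//.
  by rewrite -(inj_eq (can_inj (@conjCK C))) conjCK rmorph1 zeta0_neq1.
case: k k3 => [|[|[|k]]] // _; first by rewrite expr1; exact/eqP.
move=> x2; move/eqP: x1; apply.
by rewrite -x3 exprS x2 mulr1.
Qed.

(** Raising to the power 3^k, k the larger index, kills a rotation of smaller index and turns the
    other into a primitive cube root of unity x, giving x^2 = 1. For equal indices the letters
    coincide, giving x^4 = x = 1. *)
Lemma no_cancel_rot l l' : no_cancel l l' -> ((rot l).1 * (rot l').1) ^+ 2 <> 1.
Proof.
wlog le : l l' / (l.1 <= l'.1)%N.
  move=> W nc; case: (leqP l.1 l'.1) => [|/ltnW] le; first exact: W.
  rewrite mulrC; apply: W => //; move: nc.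
  by rewrite /no_cancel eq_sym [l.2 == _]eq_sym.
move=> nc e.
have {}e : ((rot l).1 ^+ (3 ^ l'.1) * (rot l').1 ^+ (3 ^ l'.1)) ^+ 2 = 1.
  by rewrite -exprMn exprAC e expr1n.
move: le; rewrite leq_eqVlt => /orP[/eqP le|lt]; last first.
  move: e; rewrite rot1X_gt// mul1r rot1X_eq; exact: rot0_pow.
move: nc; rewrite /no_cancel le eqxx /= negbK => /eqP e2.
have ll : l = l' by case: l l' le e2 {e} => ? ? [? ?] /= -> ->.
move: e; rewrite ll rot1X_eq -expr2 -exprM.
set x := (rot _).1; have x3 : x ^+ 3 = 1 by exact: (@rot1X_gt (0%N, l'.2) 1).
by rewrite (exprS _ 3) x3 mulr1 -[x]expr1; exact: rot0_pow.
Qed.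

(** * Reduction at a place over 5 *)

Section AtFive.
Variables (O : set C).
Hypotheses (vO : valuation_ring O) (m5 : maximal_ideal O 5).
Let hO : subring_set O := proj1 vO.
Let m := maximal_ideal O.

Lemma root_of_unity_mem n x : (0 < n)%N -> x ^+ n = 1 -> O x.
Proof.
by move=> n0 e; apply: (valuation_root vO n0); rewrite e; exact: (subring_set1 hO).
Qed.

Lemma rot1_mem l : O (rot l).1.
Proof.
by apply: (@root_of_unity_mem (3 ^ l.1.+1)); rewrite ?expn_gt0//; exact: rot1X_gt.
Qed.

(** As x has modulus 1, x^2 - 1 = x (x - x^-1). If it were in m, then x^2, a root of unity of order
    a power of 3, would equal 1, against [no_cancel_rot]. *)
Lemma no_cancel_unit l l' : no_cancel l l' ->
  let x := (rot l * rot l')%g.1 in ~ m (x - x^*).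
Proof.
move=> nc x mx; apply: (no_cancel_rot nc).
have xE : x = (rot l).1 * (rot l').1 by rewrite /x su2M1 rot2 mul0r subr0.
have xx : x * x^* = 1.
  by rewrite xE rmorphM mulrACA !rot1_norm mulr1.
pose k := (maxn l.1 l'.1).+1.
apply: (@root_of_unity_congr1 _ O vO (3 ^ k)).
- rewrite -/m; apply: (coprime_notin_maximal_ideal (p := 5) vO m5).
  by rewrite coprimeXr.
- rewrite exprAC exprMn !rot1X_gt ?mulr1 ?expr1n// ltnS;
    [exact: leq_maxr|exact: leq_maxl].
rewrite -xE -xx expr2 -mulrBr; apply: (maximal_idealM vO) => //.
by rewrite xE; apply: (subring_setM hO); exact: rot1_mem.
Qed.

(* The row of [b], scaled by 5, is [3i, 4], a vector of norm 25; modulo a place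
   over 5 the matrix [5 b] has rank one and square 0. *)
Definition row_at_five (g : su2 C) : Prop :=
  exists k c, [/\ O c, ~ m c, m (5 ^+ k * g.1 - c * (3 * 'i)) &
                  m (5 ^+ k * g.2 - c * 4)].

Lemma i_mem : O 'i.
Proof. by apply: (@root_of_unity_mem 4) => //; rewrite (exprM _ 2 2) sqrCi sqrrN expr1n. Qed.

Lemma i_notin : ~ m 'i.
Proof.
move=> mi; apply: (@maximal_ideal1 _ O); rewrite -[1]opprK -(sqrCi C) expr2 -mulrN.
by apply: (maximal_idealM vO); [exact: i_mem|exact: (maximal_idealN vO)].
Qed.

Lemma natr_notin n : coprime 5 n -> ~ m n%:R.
Proof. exact: (coprime_notin_maximal_ideal (p := 5) vO m5). Qed.

Let On n : O n%:R := subring_set_nat hO n.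

(** With d' the conjugate of d, the row (3i, 4) times diag(d, d') times 5 b equals 3i (d - d') (3i,
    4) modulo 25. The sign s covers b and its inverse. *)
Lemma row_at_five_step (g d : su2 C) (s : C) (b' : su2 C) : s = 1 \/ s = -1 ->
  b'.1 = s * b.1 -> b'.2 = s * b.2 -> d.2 = 0 -> O d.1 -> O d.1^* ->
  ~ m (d.1 - d.1^*) -> row_at_five g -> row_at_five (g * d * b')%g.
Proof.
move=> hs b'1 b'2 d2 Od Odc md [k [c [Oc mc m1 m2]]].
have [Os s2 sc] : [/\ O s, s * s = 1 & s^* = s].
  case: hs => ->; rewrite ?rmorphN rmorph1 ?mulrNN mulr1; split=> //.
    exact: (subring_set1 hO).
  by apply: (subring_setN hO); exact: (subring_set1 hO).
have ms : ~ m s.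
  move=> ms; apply: (@maximal_ideal1 _ O); rewrite -s2; exact: (maximal_idealM vO).
have O3i : O (3 * 'i) by apply: (subring_setM hO) => //; exact: i_mem.
exists k.+1, (s * (c * ((3 * 'i) * (d.1 - d.1^*)))).
have Odd : O (d.1 - d.1^*) by exact: (subring_setB hO).
have i2 : 'i * 'i = -1 :> C by rewrite -expr2 sqrCi.
have b1c : b.1^* = - ('i * 3 / 5).
  by rewrite b1 !rmorphM fmorphV !rmorph_nat /= conjCi !mulNr.
have b2c : b.2^* = 4 / 5 by rewrite b2 rmorphM fmorphV !rmorph_nat.
split.
- by apply: (subring_setM hO) => //; apply: (subring_setM hO) => //; exact: (subring_setM hO).
- move=> /(maximal_ideal_prime vO Os)[//|] /(maximal_ideal_prime vO Oc)[//|].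
  move=> /(maximal_ideal_prime vO O3i)[|//] /(maximal_ideal_prime vO (On 3))[|].
    exact: natr_notin.
  exact: i_notin.
(* The multiple of ['i * 'i + 1], which is zero, makes this a formal identity; the other correction
   term is a multiple of 25 = 9 + 16. *)
- have -> : 5 ^+ k.+1 * (g * d * b')%g.1 - s * (c * (3 * 'i * (d.1 - d.1^*))) * (3 * 'i) =
     s * d.1 * (3 * 'i) * (5 ^+ k * g.1 - c * (3 * 'i))
     - s * d.1^* * 4 * (5 ^+ k * g.2 - c * 4) - s * c * d.1^* * (5 * 5)
     + s * c * d.1^* * 9 * ('i * 'i + 1).
    by rewrite !su2M1 !su2M2 d2 b'1 b'2 rmorph0 rmorphM /= sc b2c b1 exprS; field.
  rewrite i2 addNr mulr0 addr0.
  apply: (maximal_idealB vO); first apply: (maximal_idealB vO).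
  + by apply: (maximal_idealM vO) => //; do 2?[apply: (subring_setM hO) => //].
  + by apply: (maximal_idealM vO) => //; do 2?[apply: (subring_setM hO) => //].
  + apply: (maximal_idealM vO); last exact: (maximal_idealM vO (On 5)).
    by do 2?[apply: (subring_setM hO) => //].
- have -> : 5 ^+ k.+1 * (g * d * b')%g.2 - s * (c * (3 * 'i * (d.1 - d.1^*))) * 4 =
     s * d.1 * 4 * (5 ^+ k * g.1 - c * (3 * 'i))
     - s * d.1^* * (3 * 'i) * (5 ^+ k * g.2 - c * 4).
    by rewrite !su2M2 !su2M1 d2 b'1 b'2 rmorph0 rmorphM /= sc b1c b2 exprS; field.
  apply: (maximal_idealB vO).
  + by apply: (maximal_idealM vO) => //; do 2?[apply: (subring_setM hO) => //].
  + by apply: (maximal_idealM vO) => //; do 2?[apply: (subring_setM hO) => //].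
Qed.

Definition half_turn (e : bool) : su2 C := if e then b else b^-1%g.

(** b has trace zero, so its inverse is -b. *)
Lemma half_turnE e : exists2 s, s = 1 \/ s = -1 &
  (half_turn e).1 = s * b.1 /\ (half_turn e).2 = s * b.2.
Proof.
case: e; first by exists 1; [left|rewrite !mul1r].
exists (-1); first by right.
rewrite /= b1 !rmorphM fmorphV !rmorph_nat /= conjCi !mulNr !mul1r.
by [].
Qed.

Let c n : su2 C := (a n * b * a n)%g.

(** The palindromic form of c n gives its inverse the same shape, with each factor inverted. *)
Lemma letter_half_turn l :
  letter_eval c l = (rot l * half_turn l.2 * rot l)%g.
Proof.
case: l => n [] //; rewrite /letter_eval /rot /half_turn /c /=.
by rewrite !invgM mulgA.
Qed.

(** The two rotations that meet between consecutive half turns form the diagonal factor of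
    [row_at_five_step]; the last rotation stays split off. *)
Lemma row_at_five_word w l g : row_at_five g -> path (@no_cancel nat) l w ->
  exists l' g', row_at_five g' /\ (g * rot l * word_eval c w = g' * rot l')%g.
Proof.
elim: w l g => [|l' w IH] l g hg /=.
  by exists l, g; split=> //; rewrite /word_eval big_nil mulg1.
move=> /andP[nc pw].
have [s hs [s1 s2]] := half_turnE l'.2.
have d2 : (rot l * rot l')%g.2 = 0 by rewrite su2M2 !rot2 mulr0 mul0r addr0.
have d1 : (rot l * rot l')%g.1 = (rot l).1 * (rot l').1.
  by rewrite su2M1 rot2 mul0r subr0.
have rotc k : O (rot k).1^*.
  have -> : (rot k).1^* = (rot (k.1, ~~ k.2)).1.
    by rewrite /rot; case: k => k [] //=; rewrite conjCK.
  exact: rot1_mem.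
have hg' := row_at_five_step hs s1 s2 d2 _ _ (no_cancel_unit nc) hg.
have {}hg' : row_at_five (g * (rot l * rot l') * half_turn l'.2)%g.
  apply: hg'; rewrite d1 ?rmorphM; apply: (subring_setM hO);
    by [exact: rot1_mem|exact: rotc].
have [l2 [g2 [hg2 e]]] := IH l' _ hg' pw.
exists l2, g2; split=> //; rewrite -e word_eval_cons letter_half_turn.
by rewrite !mulgA.
Qed.

Lemma row_at_five_start l : row_at_five (rot l * half_turn l.2)%g.
Proof.
have [s hs [s1 s2]] := half_turnE l.2.
have Os : O s by case: hs => ->; [|apply: (subring_setN hO)]; exact: (subring_set1 hO).
have ss : s * s = 1 by case: hs => ->; rewrite ?mulrNN mulr1.
have m0 := maximal_ideal0 vO.
have Oc : O (s * (rot l).1) by apply: (subring_setM hO) => //; exact: rot1_mem.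
exists 1%N, (s * (rot l).1); split=> //.
- move=> /(maximal_ideal_prime vO Os)[ms|].
    by apply: (@maximal_ideal1 _ O); rewrite -ss; exact: (maximal_idealM vO).
  move=> mr; apply: (@maximal_ideal1 _ O).
  have e3 : (0 < 3 ^ l.1.+1)%N by rewrite expn_gt0.
  rewrite -[1](@rot1X_gt l l.1.+1)// -(prednK e3) exprSr.
  apply: (maximal_idealM vO) => //; apply: (subring_setX hO); exact: rot1_mem.
- rewrite su2M1 rot2 mul0r subr0 s1 b1 expr1.
  by have -> : 5 * ((rot l).1 * (s * ('i * 3 / 5))) - s * (rot l).1 * (3 * 'i) = 0 by field.
- rewrite su2M2 rot2 mul0r addr0 s2 b2 expr1.
  by have -> : 5 * ((rot l).1 * (s * (4 / 5))) - s * (rot l).1 * 4 = 0 by field.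
Qed.

(** A nonempty reduced word equals g times a diagonal matrix, with 5^k g.2 congruent to 4 u for a
    unit u, so its second entry cannot vanish. *)
Lemma rotations_free_at_five w :
  sorted (@no_cancel nat) w -> word_eval c w = 1%g -> w = [::].
Proof.
case: w => // l w /= pw; rewrite word_eval_cons letter_half_turn => e.
have [l' [g [[k [u [Ou mu _ m2]]] e']]] := row_at_five_word (row_at_five_start l) pw.
have : (g * rot l')%g.2 = 0 by rewrite -e' e.
rewrite su2M2 rot2 mulr0 add0r => /eqP; rewrite mulf_eq0.
have -> : (rot l').1^* == 0 = false.
  by apply/negP => /eqP r0; have := rot1_norm l'; rewrite r0 mulr0 => /esym/eqP; rewrite oner_eq0.
rewrite orbF => /eqP g2; move: m2; rewrite g2 mulr0 sub0r => /(maximal_idealN vO).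
rewrite opprK => /(maximal_ideal_prime vO Ou)[//|m4].
by have := @natr_notin 4 isT m4.
Qed.

End AtFive.

Lemma rotations_free w : sorted (@no_cancel nat) w ->
  word_eval (fun n => (a n * b * a n)%g) w = 1%g -> w = [::].
Proof.
have [O [vO m5]] := @exists_valuation_ring_nat C 5 isT.
exact: (rotations_free_at_five vO m5).
Qed.

End FreeRotations.

(** * Approximation and conclusion *)

Lemma exists_cube_root_tower (C : numClosedFieldType) : exists zeta : nat -> C,
  zeta 0%N ^+ 2 + zeta 0%N + 1 = 0 /\ forall n, zeta n.+1 ^+ 3 = zeta n.
Proof.
pose w : C := (-1 + 'i * sqrtC 3) / 2.
exists (fun n => iter n 3.-root w); split=> [|n] /=; last by rewrite rootCK.
have -> : w ^+ 2 + w + 1 = (3 + 'i ^+ 2 * sqrtC 3 ^+ 2) / 4 by rewrite /w; field.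
by rewrite sqrCi sqrtCK; ring.
Qed.

Lemma exists_su2 (C : numClosedFieldType) (x y : C) :
  x * x^* + y * y^* = 1 -> exists g : su2 C, g.1 = x /\ g.2 = y.
Proof. by move=> /eqP h; exists (@SU2 C (x, y) h). Qed.

Lemma norm_subX (R : numDomainType) (x y : R) n : `|x| = 1 -> `|y| = 1 ->
  `|x ^+ n - y ^+ n| <= n%:R * `|x - y|.
Proof.
move=> x1 y1; elim: n => [|n IH]; first by rewrite subrr normr0 mul0r.
have -> : x ^+ n.+1 - y ^+ n.+1 = x * (x ^+ n - y ^+ n) + (x - y) * y ^+ n.
  by rewrite !exprS; ring.
apply: le_trans (ler_normD _ _) _; rewrite !normrM normrX x1 y1 expr1n mul1r mulr1.
by rewrite -natr1 mulrDl mul1r lerD2r.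
Qed.

Lemma norm_conj1 (C : numClosedFieldType) (x : C) : x * x^* = 1 -> `|x| = 1.
Proof.
by move=> xx; apply/eqP; rewrite -(pexpr_eq1 (n := 2))// normCK xx.
Qed.

Lemma eventually_inv_lt (C : archiClosedFieldType) (e : C) : 0 < e ->
  exists N, forall p, (N <= p)%N -> p.+1%:R^-1 < e.
Proof.
move=> e0; exists (Num.bound e^-1) => p Np.
have ei : 0 < e^-1 by rewrite invr_gt0.
have h : e^-1 < p.+1%:R.
  apply: lt_trans (archi_boundP (ltW ei)) _.
  by rewrite ltr_nat ltnS.
by rewrite -[e]invrK ltf_pV2// posrE ltr0n.
Qed.

(** * Approximation by matrices congruent to 1 *)

Section Approximation.
Variables (C : archiClosedFieldType) (b : su2 C).
Hypotheses (b1 : b.1 = 'i * 3 / 5) (b2 : b.2 = 4 / 5).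

Lemma half_turn_conj : b.1^* = - b.1 /\ b.2^* = b.2.
Proof.
rewrite b1 b2 !rmorphM !fmorphV !rmorph_nat /= conjCi; split=> //.
by rewrite !mulNr.
Qed.

Lemma half_turn_order : (b ^+ 4 = 1)%g.
Proof.
have [b1c b2c] := half_turn_conj.
have s1 : (b ^+ 2)%g.1 = -1.
  rewrite expg2 su2M1 b2c b1 b2.
  have -> : 'i * 3 / 5 * ('i * 3 / 5) - 4 / 5 * (4 / 5) =
    ('i ^+ 2 * 9 - 16) / 25 :> C by field.
  by rewrite sqrCi; field.
have s2 : (b ^+ 2)%g.2 = 0 by rewrite expg2 su2M2 b1c; ring.
have [e1 e2] := su2_diagX 2 s2.
rewrite (expgnA b 2 2); apply: su2_ext; rewrite ?e2// e1 s1 sqrrN expr1n //.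
Qed.

(** Both s and t are rational in T = 1 - 1 / (p + 1), which lies in m: they give 1 at T = 0, and z
    and b respectively at T = 1. *)
Lemma approximation (z : C) (M N : nat) (e : C) :
  z * z^* = 1 -> z ^+ M.+1 = 1 -> z != -1 -> 0 < e ->
  exists O, [/\ valuation_ring O,
    forall n, (0 < n <= N)%N -> ~ maximal_ideal O n%:R &
    exists s t : su2 C, [/\ su2_congr O s, su2_congr O t, s.2 = 0,
      `|s.1 - z| < e & su2_len (t / b)%g < e]].
Proof.
move=> zz zM zN1 e0; have z1 := norm_conj1 zz.
pose kap := `|1 + z|.
have kap0 : 0 < kap by rewrite normr_gt0 addrC addr_eq0.
(* For d = 1 / (p + 1): d < kap / 2 keeps the denominator of s away from 0, d < e kap / 4 controls
   s, and d < e / 2 controls t. *)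
have [N1 hN1] := eventually_inv_lt (divr_gt0 kap0 (ltr0n C 2)).
have [N2 hN2] := eventually_inv_lt (divr_gt0 (mulr_gt0 e0 kap0) (ltr0n C 4)).
have [N3 hN3] := eventually_inv_lt (divr_gt0 e0 (ltr0n C 2)).
(* p > 5 makes the denominator of b a unit in O. *)
have [p pN pp] := prime_above (maxn (maxn (maxn N 5) N1) (maxn N2 N3)).
move: pN; rewrite !gtn_max -!andbA => /and5P[Np p5 /ltnW/hN1 d1 /ltnW/hN2 d2 /ltnW/hN3 d3].
have [O [vO mp]] := @exists_valuation_ring_nat C p (prime_gt1 pp).
have unitO n : (0 < n < p)%N -> ~ maximal_ideal O n%:R.
  move=> /andP[n0 np]; apply: (coprime_notin_maximal_ideal vO mp).
  by rewrite prime_coprime// gtnNdvd.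
have hO := proj1 vO; set m := maximal_ideal O in mp unitO.
exists O; split=> // [n /andP[n0 nN]|].
  by apply: unitO; rewrite n0 (leq_ltn_trans nN).
have [d dE] : exists d : C, d = p.+1%:R^-1 by eexists.
rewrite -dE in d1 d2 d3.
have p10 : p.+1%:R != 0 :> C by rewrite pnatr_eq0.
have d0 : 0 < d by rewrite dE invr_gt0 ltr0n.
have d11 : d <= 1 by rewrite dE invf_le1 ?ler1n ?ltr0n.
have dc : d^* = d by rewrite dE fmorphV rmorph_nat.
have [T TE] : exists T : C, T = 1 - d by eexists.
have Tc : T^* = T by rewrite TE rmorphB rmorph1 /= dc.
have md : m (d - 1).
  by rewrite dE; apply: (congr1V vO); rewrite -natr1 addrK.
have mT : m T by rewrite TE -opprB; exact: (maximal_idealN vO).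
have OT : O T by exact: maximal_ideal_sub.
have m1T x : O x -> m (1 + T * x - 1).
  by move=> Ox; rewrite addrAC subrr add0r mulrC; exact: (maximal_idealM vO).
have unit_neq0 x : m (x - 1) -> x != 0.
  by move=> /(congr1_notin vO); apply: contra_notN => /eqP ->; exact: (maximal_ideal0 vO).
have Oz : O z by exact: (root_of_unity_mem vO (ltn0Sn M)).
have Ozc : O z^* by apply: (root_of_unity_mem vO (ltn0Sn M)); rewrite -rmorphXn zM rmorph1.
have mA := m1T _ Oz; have mB := m1T _ Ozc; have mD := m1T _ OT.
have A0 := unit_neq0 _ mA; have B0 := unit_neq0 _ mB; have D0 := unit_neq0 _ mD.
have Ac : (1 + T * z)^* = 1 + T * z^* by rewrite rmorphD rmorph1 rmorphM /= Tc.
(* A quotient of conjugates has modulus 1; at T = 1 it is z because z z^* = 1. *)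
have [s [s1 s2]] : exists g : su2 C, g.1 = (1 + T * z) / (1 + T * z^*) /\ g.2 = 0.
  apply: exists_su2; rewrite rmorph0 mulr0 addr0 rmorphM fmorphV -Ac /= conjCK.
  by rewrite Ac; field; rewrite A0 B0.
have s1c : s.1^* = (1 + T * z^*) / (1 + T * z).
  by rewrite s1 rmorphM fmorphV -Ac /= conjCK.
have [b1c b2c] := half_turn_conj.
have [D DE] : exists D : C, D = 1 + T * T by eexists.
have Dn0 : D != 0 by rewrite DE.
have Dc : D^* = D by rewrite DE rmorphD rmorph1 rmorphM /= Tc.
have bb : b.1 * b.1 = b.2 * b.2 - 1.
  by have := su2_normE b; rewrite b1c b2c => <-; ring.
have conj1 x : (((1 - T * T) + 2 * T * x) / D)^* = ((1 - T * T) + 2 * T * x^*) / D.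
  rewrite rmorphM fmorphV /= Dc; congr (_ / _).
  by rewrite rmorphD rmorphB rmorph1 !rmorphM rmorph_nat /= Tc.
have conj2 x : (2 * T * x / D)^* = 2 * T * x^* / D.
  by rewrite !rmorphM fmorphV /= Dc rmorph_nat Tc.
(* t is (1 + T b)^2 / (1 + T^2), expanded with b^2 = -1. *)
have [t [t1 t2]] : exists g : su2 C,
    g.1 = ((1 - T * T) + 2 * T * b.1) / D /\ g.2 = 2 * T * b.2 / D.
  apply: exists_su2; rewrite conj1 conj2 b1c b2c.
  have -> : ((1 - T * T) + 2 * T * b.1) / D * ((1 - T * T + 2 * T * - b.1) / D)
    + 2 * T * b.2 / D * (2 * T * b.2 / D) =
   ((1 - T * T) ^+ 2 + 4 * T ^+ 2 * (b.2 * b.2 - b.1 * b.1)) / D ^+ 2 by field.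
  by rewrite bb DE; field.
have O2 : O 2 by exact: (subring_set_nat hO 2).
have Oi : O 'i by exact: (i_mem vO).
have O5 : O 5^-1.
  apply: valuation_inv; first exact: (subring_set_nat hO 5).
  by apply: unitO; rewrite p5.
have Ob1 : O b.1.
  rewrite b1; do 2?[apply: (subring_setM hO) => //]; exact: (subring_set_nat hO 3).
have Ob2 : O b.2.
  by rewrite b2; apply: (subring_setM hO) => //; exact: (subring_set_nat hO 4).
have OD : O D^-1 by apply: (congr1_mem vO); rewrite DE; exact: (congr1V vO).
have m2T : m (2 * T) by exact: (maximal_idealM vO).
have mt b' : O b' -> m (((1 - T * T) + 2 * T * b') / D - 1).
  move=> Ob'; have -> : ((1 - T * T) + 2 * T * b') / D - 1 =
    (b' - T) / D * (2 * T) by rewrite DE; field.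
  apply: (maximal_idealM vO) => //; apply: (subring_setM hO) => //; exact: (subring_setB hO).
have mt2 : m (2 * T * b.2 / D).
  rewrite -mulrA mulrC; apply: (maximal_idealM vO) => //; exact: (subring_setM hO).
exists s, t; split.
- split; rewrite ?s2 ?rmorph0; try exact: (maximal_ideal0 vO).
    by rewrite s1; apply: (congr1M vO) => //; exact: (congr1V vO).
  by rewrite s1c; apply: (congr1M vO) => //; exact: (congr1V vO).
- split.
  + by rewrite t1; exact: mt.
  + by rewrite t1 conj1 b1c; apply: mt; exact: (subring_setN hO).
  + by rewrite t2.
  + by rewrite t2 conj2 b2c.
- by [].
- have -> : s.1 - z = d * (1 - z) / (1 + T * z^*).
    have -> : s.1 - z = ((1 + T * z) - z - T * (z * z^*)) / (1 + T * z^*).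
      by rewrite s1; field.
    by rewrite zz TE; congr (_ / _); ring.
  rewrite !normrM normfV (ger0_norm (ltW d0)) ltr_pdivrMr ?normr_gt0//.
  have n2 : `|1 - z| <= 2.
    by apply: le_trans (ler_normB _ _) _; rewrite normr1 z1.
  (* |1 + T z^*| is at least |1 + z| - d, and d < kap / 2. *)
  have lb : kap / 2 <= `|1 + T * z^*|.
    have -> : 1 + T * z^* = (1 + z^*) - d * z^* by rewrite TE; ring.
    apply: le_trans (lerB_dist _ _).
    have -> : `|1 + z^*| = kap by rewrite -[1 + z^*]conjCK norm_conjC rmorphD rmorph1 /= conjCK.
    rewrite normrM norm_conjC z1 mulr1 (ger0_norm (ltW d0)).
    have -> : kap / 2 = kap - kap / 2 by field.
    by rewrite lerD2l lerN2 ltW.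
  apply: (le_lt_trans (y := d * 2)); first by rewrite ler_pM2l.
  apply: (lt_le_trans (y := e * (kap / 2))); last by rewrite ler_pM2l.
  have -> : e * (kap / 2) = (e * kap / 4) * 2 by field.
  by rewrite ltr_pM2r// ltr0n.
have -> : su2_len (t / b)%g = 2 * (d * d) / D.
  have e1 : (t / b)%g.1 = ((1 - T * T) * - b.1 + 2 * T * (b.2 * b.2 - b.1 * b.1)) / D.
    by rewrite su2M1 su2V1 su2V2 t1 t2 rmorphN /= b2c b1c; field.
  have e2 : (t / b)%g.1^* = ((1 - T * T) * b.1 + 2 * T * (b.2 * b.2 - b.1 * b.1)) / D.
    rewrite e1 rmorphM fmorphV /= Dc; congr (_ / _).
    rewrite rmorphD !rmorphM rmorph_nat /= Tc; congr (_ * _ + _ * _).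
    - by rewrite rmorphB rmorph1 rmorphM /= Tc.
    - by rewrite rmorphN /= b1c opprK.
    - by rewrite rmorphB !rmorphM /= b1c b2c mulrNN.
  by rewrite /su2_len /su2_tr e2 e1 bb DE TE; field; rewrite -TE -DE.
have D1 : 1 <= D.
  by rewrite DE lerDl -{2}Tc mul_conjC_ge0.
have D00 : 0 < D by exact: lt_le_trans D1.
rewrite ltr_pdivrMr//; apply: (lt_le_trans (y := e)); last by rewrite ler_peMr// ltW.
apply: (le_lt_trans (y := 2 * d)); last by rewrite mulrC -ltr_pdivlMr ?ltr0n.
by rewrite ler_pM2l ?ltr0n// ler_piMr// ltW.
Qed.

End Approximation.

Lemma su2_diag_norm (C : numClosedFieldType) (g : su2 C) : g.2 = 0 -> `|g.1| = 1.
Proof.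
by move=> g2; apply: norm_conj1; have := su2_normE g; rewrite g2 mul0r addr0.
Qed.

Lemma su2_len_diag (C : numClosedFieldType) (g h : su2 C) : g.2 = 0 -> h.2 = 0 ->
  su2_len (g / h)%g = `|g.1 - h.1| ^+ 2.
Proof.
move=> g2 h2; have hh : h.1 * h.1^* = 1.
  by have := su2_normE h; rewrite h2 mul0r addr0.
have e1 : (g / h)%g.1 - 1 = (g.1 - h.1) * h.1^*.
  by rewrite su2M1 su2V1 g2 mul0r subr0 mulrBl hh.
have e2 : (g / h)%g.2 = 0 by rewrite su2M2 su2V2 g2 h2 oppr0 mulr0 mul0r addr0.
rewrite su2_lenE e1 e2 mul0r addr0 rmorphM /= conjCK mulrACA [_ * h.1]mulrC hh mulr1.
by rewrite normCK.
Qed.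

(** The factor 3^k in the accuracy of s k compensates for later raising s k to powers 3^(k - n),
    which expands distances by at most 3^k. *)
Lemma congruence_lift (C : archiClosedFieldType) (zeta : nat -> C) (b : su2 C) :
  zeta 0%N ^+ 2 + zeta 0%N + 1 = 0 -> (forall n, zeta n.+1 ^+ 3 = zeta n) ->
  b.1 = 'i * 3 / 5 -> b.2 = 4 / 5 ->
  exists O : nat -> set C, [/\ forall k, valuation_ring (O k),
    forall k n, (0 < n <= k)%N -> ~ maximal_ideal (O k) n%:R &
    exists s t : congr_seq O, [/\ forall k, (s k).2 = 0,
      forall k, `|(s k).1 - zeta k| < (k.+1 * 3 ^ k)%:R^-1 &
      forall k, su2_len (t k / b)%g < k.+1%:R^-1]].
Proof.
move=> z0 zS b1 b2.
have step k : exists x : set C * su2 C * su2 C, [/\ valuation_ring x.1.1,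
    forall n, (0 < n <= k)%N -> ~ maximal_ideal x.1.1 n%:R,
    su2_congr x.1.1 x.1.2 /\ su2_congr x.1.1 x.2,
    x.1.2.2 = 0 /\ `|x.1.2.1 - zeta k| < (k.+1 * 3 ^ k)%:R^-1 &
    su2_len (x.2 / b)%g < k.+1%:R^-1].
  have e30 : (0 < 3 ^ k)%N by rewrite expn_gt0.
  have zk : zeta k ^+ (3 ^ k.+1).-1.+1 = 1.
    by rewrite prednK ?expn_gt0//; exact: (zetaX_gt z0 zS).
  have e0 : 0 < (k.+1 * 3 ^ k)%:R^-1 :> C by rewrite invr_gt0 ltr0n muln_gt0.
  (* zeta k has odd order. *)
  have zN1 : zeta k != -1.
    apply/eqP => zN; move: zk; rewrite zN prednK ?expn_gt0//.
    rewrite -signr_odd oddX /= expr1 => /eqP; rewrite eq_sym -subr_eq0 opprK.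
    by rewrite (_ : 1 + 1 = 2%:R)// pnatr_eq0.
  have [O [vO uO [s [t [cs ct s2 s1 tb]]]]] :=
    approximation b1 b2 k (zeta_norm z0 zS k) zk zN1 e0.
  exists (O, s, t); split=> //; apply: (lt_le_trans tb).
  by rewrite lef_pV2 ?posrE ?ltr0n ?muln_gt0// ler_nat leq_pmulr.
have [x xP] := choice step.
exists (fun k => (x k).1.1); split=> [k|k|]; [by case: (xP k)|by case: (xP k)|].
have cs k : su2_congr (x k).1.1 (x k).1.2 by case: (xP k) => _ _ [].
have ct k : su2_congr (x k).1.1 (x k).2 by case: (xP k) => _ _ [].
exists (CongrSeq cs), (CongrSeq ct).
by split=> k /=; case: (xP k) => _ _ _ [].
Qed.

(** * The free family in the cokernel *)

Lemma coker_proj_eq1 (H G : groupType) (f : {multiplicative H -> G}) (g : G) :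
  coker_proj f g = 1%g -> normal_closure (range f) g.
Proof. by move=> /(coker_eqP f g 1); rewrite invg1 mulg1. Qed.

Lemma normal_closure_kernel (H G D : groupType) (f : {multiplicative H -> G})
  (phi : {multiplicative G -> D}) (g : G) :
  (forall x, phi (f x) = 1%g) -> normal_closure (range f) g -> phi g = 1%g.
Proof.
move=> phif /(_ [set x | phi x = 1%g]); apply; split=> [|_ [x _ <-]]; last exact: phif.
split=> [|x y|x|x y] /=; rewrite ?hom1//.
- by rewrite gmulfM => -> ->; rewrite mulg1.
- by rewrite homV => ->; rewrite invg1.
- by rewrite conjgE !gmulfM homV => ->; rewrite mul1g mulVg.
Qed.

Lemma free_hom_trivial (X : Type) (F D : groupType) (b : X -> F)
  (phi : {multiplicative F -> D}) :
  is_free_on b -> (forall x, phi (b x) = 1%g) -> forall g, phi g = 1%g.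
Proof.
move=> freeb phib g.
have oneM : {morph (fun _ : F => 1%g : D) : x y / (x * y)%g} by move=> x y; rewrite mulg1.
have [f0 _ uniq] := freeb D (fun=> 1%g).
by rewrite (uniq phi phib) -(uniq (hom_of_morph oneM)).
Qed.

Lemma coker_rationalization_free (F2 B : groupType) (b : 'I_2 -> F2)
  (eta : {multiplicative F2 -> B}) :
  is_free_on b -> is_baumslag_rationalization eta ->
  exists c : nat -> coker eta,
    forall w, sorted (@no_cancel nat) w -> word_eval c w = 1%g -> w = [::].
Proof.
move=> freeb [udB univ].
have [zeta [z0 zS]] := exists_cube_root_tower algC.
have /choice[a aP] : forall n, exists g : su2 algC, g.1 = zeta n /\ g.2 = 0.
  by move=> n; apply: exists_su2; rewrite (zeta_norm z0 zS) mul0r addr0.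
have a1 n := (aP n).1; have a2 n := (aP n).2.
have [q [q1 q2]] : exists q : su2 algC, q.1 = 'i * 3 / 5 /\ q.2 = 4 / 5.
  apply: exists_su2; rewrite !rmorphM !fmorphV !rmorph_nat /= conjCi.
  have -> : 'i * 3 / 5 * (- 'i * 3 / 5) + 4 / 5 * (4 / 5) =
    (16 - 9 * 'i ^+ 2) / 25 :> algC by field.
  by rewrite sqrCi; field.
have [O [vO uO [s [t [s2 s1 tq]]]]] := congruence_lift z0 zS q1 q2.
have udE := congr_group_uniquely_divisible vO uO.
have [phi phiE] := congr_to_limit vO.
pose cl := congr_class vO.
pose x := cl (CongrSeq (fun k => su2_congrX (vO k) (3 ^ k.+1) (congr_seqP s k))).
(* This is a 3^(n+1)-th root of x because (k - n) + (n + 1) = k + 1 for n <= k; the truncated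
   difference affects only finitely many terms. *)
pose r n := cl (CongrSeq (fun k => su2_congrX (vO k) (3 ^ (k - n)) (congr_seqP s k))).
have rX n : (r n ^+ (3 ^ n.+1))%g = x.
  rewrite /r /cl congr_classX; apply/gclassP; exists n => k nk /=.
  by rewrite -expgnA -expnD addnS subnK.
have phir n : phi (r n) = limit_const (a n).
  rewrite phiE; apply/gclassP => e e0.
  have [N hN] := eventually_inv_lt e0; exists (maxn n N) => k.
  rewrite geq_max => /andP[nk /hN ke] /=.
  have [p1 p2] := su2_diagX (3 ^ (k - n)) (s2 k).
  rewrite su2_len_diag// p1 a1 -(zetaX_le zS nk).
  set dd := `|_|; have dk : dd <= k.+1%:R^-1.
    apply: le_trans (norm_subX _ _ _) _.
    - exact: su2_diag_norm.
    - exact: norm_conj1 (zeta_norm z0 zS k).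
    apply: (le_trans (y := (3 ^ k)%:R * (k.+1 * 3 ^ k)%:R^-1)).
      apply: ler_pM; [exact: ler0n|exact: normr_ge0| |exact: ltW (s1 k)].
      by rewrite ler_nat leq_pexp2l// leq_subr.
    rewrite natrM invfM mulrCA mulfV ?mulr1// pnatr_eq0 -lt0n expn_gt0//.
  (* The length is the square of [dd], at most [dd] since [dd] is at most 1. *)
  apply: le_lt_trans ke; apply: le_trans (dk); rewrite expr2 ler_piMr ?normr_ge0//.
  by apply: le_trans dk _; rewrite invf_le1 ?ltr0n// ler1n.
have phit : phi (cl t) = limit_const q.
  rewrite phiE; apply/gclassP => e e0.
  by have [N hN] := eventually_inv_lt e0; exists N => k /hN; apply: lt_trans.
have phix : phi x = 1%g.
  rewrite -(rX 0%N) homX phir -homX -(hom1 (@limit_const algC)).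
  congr limit_const; have [e1 e2] := su2_diagX 3 (a2 0%N).
  by apply: su2_ext; rewrite ?e2// e1 a1 (zeta0_cube z0).
have phiy : phi (cl t ^+ 4)%g = 1%g.
  by rewrite homX phit -homX (half_turn_order q1 q2) hom1.
(* Both prescribed images die in the limit group, while their roots [r n] and [cl t] survive
   there. *)
have [f fE _] := freeb _ (fun i : 'I_2 => if i == ord0 then x else (cl t ^+ 4)%g).
have [ft ftE _] := univ _ udE f.
pose Phi : {multiplicative B -> limit_group algC} := phi \o ft.
have Phi_eta g : Phi (eta g) = 1%g.
  apply: (free_hom_trivial (phi := Phi \o eta : {multiplicative _ -> _}) freeb) => i.
  have /= e := ftE (b i); have /= e' := fE i.
  by rewrite /= e e'; case: eqP.
have rootP n : exists h : B, (h ^+ (3 ^ n.+1))%g = eta (b ord0).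
  have e3 : (0 < 3 ^ n.+1)%N by rewrite expn_gt0.
  by have /uniquely_divisibleP/(_ (3 ^ n.+1).-1)[_] := udB; rewrite prednK//; exact.
have [A AP] := choice rootP.
have [u uP] : exists u : B, (u ^+ 4)%g = eta (b (@Ordinal 2 1 isT)).
  by have /uniquely_divisibleP/(_ 3%N)[_] := udB; exact.
(* Roots are unique in the source of [phi], so [ft] sends A n to r n. *)
have PhiA n : Phi (A n) = limit_const (a n).
  rewrite -phir /Phi /=; congr (phi _).
  have e3 : (0 < 3 ^ n.+1)%N by rewrite expn_gt0.
  have /uniquely_divisibleP/(_ (3 ^ n.+1).-1)[+ _] := udE; rewrite prednK//; apply.
  rewrite rX -homX AP; have /= -> := ftE (b ord0); exact: fE ord0.
have Phiu : Phi u = limit_const q.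
  rewrite -phit /Phi /=; congr (phi _).
  have /uniquely_divisibleP/(_ 3%N)[+ _] := udE; apply.
  by rewrite -homX uP; have /= -> := ftE (b (@Ordinal 2 1 isT)); have /= -> := fE (@Ordinal 2 1 isT).
pose c n := (A n * u * A n)%g.
exists (coker_proj eta \o c) => w sw; rewrite word_eval_hom => /coker_proj_eq1.
(* Phi kills the normal closure of the image of eta, so a relation among the classes of the c n
   yields one among the rotations a n q a n. *)
move=> /(normal_closure_kernel Phi_eta); rewrite -word_eval_hom.
rewrite (@eq_word_eval _ _ _ (@limit_const algC \o (fun n => a n * q * a n)%g)); last first.
  by move=> n; rewrite -[LHS]/(Phi (c n)) !gmulfM PhiA Phiu -!limit_constM.
rewrite word_eval_hom => /limit_const_eq1.
exact: (rotations_free z0 zS a1 a2 q1 q2 sw).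
Qed.

Local Close Scope ring_scope.
Local Open Scope group_scope.

Theorem mainTheorem1 :
  (forall (F2 B : groupType) (b : 'I_2 -> F2) (eta : {multiplicative F2 -> B}),
     is_free_on b ->
     is_baumslag_rationalization eta ->
     has_free_subgroup_of_countable_rank (coker eta)) /\
  ~ (forall (L : localization) (G : groupType) (x y : coker (loc_eta L G)),
       x * y = y * x).
Proof.
split=> [F2 B b eta freeb ratB|comm].
  have [c cP] := coker_rationalization_free freeb ratB.
  exact: free_subgroup_of_countable_rank cP.
(* The Baumslag localization at a free group of rank 2 refutes commutativity, since two members of
   the free family do not commute. *)
have [c cP] := coker_rationalization_free (@free_groupP 'I_2) (baumslagP _).
apply: (@free_not_commutative _ _ c 0%N 1%N cP isT).
exact: (comm baumslag_localization (free_group 'I_2)).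
Qed.
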